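(* For a measurable Abelian group $(\mathfrak{X},+,\mathcal{A})$, $n\in\mathbb{N}$ and probability distributions $F_1,\dots,F_n,G\in\mathcal{F}$ on $(\mathfrak{X},\mathcal{A})$, let $W_\ell$ and $\eta_\ell$ ($\ell\in\{0,\dots,n\}$), the constant $c_1$, and $\overline{F}=\frac1n\sum_{j=1}^nF_j$ be as defined in the context. (a) For $\ell\in\mathbb{Z}_+=\{0,1,2,\dots\}$ let $u_\ell$ be the smallest possible constant such that, for all such $\mathfrak{X}$, all $n\in\mathbb{N}$ with $n\geq\ell$, and all $F_1,\dots,F_n,G\in\mathcal{F}$ (without any restriction on $\eta_0$), \[\Big\|\prod_{j=1}^nF_j-W_\ell\Big\|\leq u_\ell\,\eta_0^{(\ell+1)/2}.\] Then \[u_\ell\leq\frac{(2e\,c_1)^{(\ell+1)/2}}{1-x_\ell},\] where $x_\ell\in(0,1)$ is the unique positive solution of the equation $x^{\ell+1}+x/2=1$. In particular $u_0\leq5.9$, $u_1\leq17.3$, $u_2\leq44.5$, and $u_3\leq107.5$. (b) For $\ell\in\mathbb{N}$ let $\widetilde{u}_\ell$ be the smallest possible constant such that, for all such $\mathfrak{X}$, all $n\in\mathbb{N}$ with $n\geq\ell$, and all $F_1,\dots,F_n\in\mathcal{F}$, under the assumption $G=\overline{F}$ (and without any restriction on $\eta_1$), \[\Big\|\prod_{j=1}^nF_j-W_\ell\Big\|\leq\widetilde{u}_\ell\,\eta_1^{(\ell+1)/2}.\] Then \[\widetilde{u}_1\leq10.94,\quad\widetilde{u}_2\leq31.5,\quad\widetilde{u}_3\leq82.2,\quad\widetilde{u}_\ell\leq\frac{(2e\,c_1)^{(\ell+1)/2}}{1-\widetilde{x}_\ell}\quad(\ell\geq4),\]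 where $\widetilde{x}_\ell\in(0,1)$ is the unique positive solution of the equation $\widetilde{x}^{\,\ell+1}-\widetilde{x}^{\,2}/2+\widetilde{x}=1$.
   Context: A measurable Abelian group $(\mathfrak{X},+,\mathcal{A})$ is a commutative group $(\mathfrak{X},+)$ with identity $0$ together with a $\sigma$-algebra $\mathcal{A}$ on $\mathfrak{X}$ such that $(x,y)\mapsto x-y$ is measurable from $(\mathfrak{X}\times\mathfrak{X},\mathcal{A}\otimes\mathcal{A})$ to $(\mathfrak{X},\mathcal{A})$. $\mathcal{F}$ is the set of probability distributions and $\mathcal{M}$ the set of finite signed measures on $(\mathfrak{X},\mathcal{A})$. Products and powers of elements of $\mathcal{M}$ are convolutions: $VW(A)=\int_{\mathfrak{X}}V(A-x)\,dW(x)$; empty products and zeroth powers equal $I$, the Dirac measure at $0$. $\|V\|=(V^++V^-)(\mathfrak{X})$ is the total variation norm, where $V=V^+-V^-$ is the Hahn–Jordan decomposition. Given $n\in\mathbb{N}$ and $F_1,\dots,F_n,G\in\mathcal{F}$, define \[V_k=\sum_{J\subseteq\{1,\dots,n\}:\,|J|=k}\prod_{j\in J}(F_j-G)\ (k\in\{0,\dots,n\}),\qquad W_\ell=\sum_{k=0}^\ell V_kG^{n-k}\ (\ell\in\{0,\dots,n\}),\] \[M_{j,k}=(F_j-G)G^{\lfloor(n-k)/k\rfloor},\quad\nu_{k,m}=\sum_{j=1}^n\|M_{j,k}\|^m,\quad\widetilde{\nu}_k=\Big\|\sum_{j=1}^nM_{j,k}\Big\|\quad(j,k\in\{1,\dots,n\},\,m\in\mathbb{N}),\]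 \[\eta_\ell=\max_{k\in\{\ell+1,\dots,n\}}\Big[\frac1k\Big(\frac{\widetilde{\nu}_k^2}{4c_1}+\nu_{k,2}\Big)\Big]\ (\ell\in\{0,\dots,n\}),\qquad c_1=\sup_{x\in(0,\infty)}\frac{\ln(2-(1-x)e^x)}{x^2}=0.694025\ldots.\] A maximum over the empty set is read as $0$. *)

(* Defs.v *)
From HB Require Import structures.
From mathcomp Require Import all_boot all_order all_algebra.
From mathcomp Require Import all_classical all_reals all_analysis.
From mathcomp Require Import measurable_realfun.

Set Implicit Arguments.
Unset Strict Implicit.
Unset Printing Implicit Defensive.

Import Order.TTheory GRing.Theory Num.Theory.
Import numFieldNormedType.Exports.

Local Open Scope classical_set_scope.
Local Open Scope ring_scope.

(* Hierarchy Builder has no structure joining pointed types and additive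
   structures without a topology, so Measurable and GRing.Zmodule cannot be
   extended together (PseudoMetricNormedZmod lies below both). The group laws
   are fields of the mixin instead, and the zmodType structure is derived. *)
HB.mixin Record isMeasurableAbGroup d T & Measurable d T := {
  mg_zero : T;
  mg_opp : T -> T;
  mg_add : T -> T -> T;
  mg_addA : associative mg_add;
  mg_addC : commutative mg_add;
  mg_add0 : left_id mg_zero mg_add;
  mg_addN : left_inverse mg_zero mg_opp mg_add;
  mg_measurable_sub :
    measurable_fun [set: T * T] (fun z : T * T => mg_add z.1 (mg_opp z.2)) }.

#[short(type="measurableAbGroupType")]
HB.structure Definition MeasurableAbGroup d :=
  {T of Measurable d T & isMeasurableAbGroup d T}.

HB.instance Definition _ d (T : measurableAbGroupType d) :=
  GRing.isZmodule.Build (MeasurableAbGroup.sort T)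
    (@mg_addA d T) (@mg_addC d T) (@mg_add0 d T) (@mg_addN d T).

Lemma measurable_sub d (T : measurableAbGroupType d) :
  measurable_fun [set: T * T] (fun z : T * T => z.1 - z.2).
Proof. exact: mg_measurable_sub. Qed.


Section charge_integral.
Context d (T : measurableType d) (R : realType).
Implicit Types nu : {charge set T -> \bar R}.

Let hahn_pos nu : set T := sval (cid (Hahn_decomposition nu)).

Let hahn_neg nu : set T := sval (cid (svalP (cid (Hahn_decomposition nu)))).

Lemma hahn_posneg nu : hahn_decomposition nu (hahn_pos nu) (hahn_neg nu).
Proof. exact: svalP (cid (svalP (cid (Hahn_decomposition nu)))). Qed.

Definition charge_pos nu : {finite_measure set T -> \bar R} :=
  jordan_pos (hahn_posneg nu).

Definition charge_neg nu : {finite_measure set T -> \bar R} :=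
  jordan_neg (hahn_posneg nu).

(* Does not depend on the choice of Hahn decomposition, see charge_normE. *)
Definition charge_norm nu : R :=
  fine (charge_variation (hahn_posneg nu) [set: T]).

Lemma charge_normE nu P N (nuPN : hahn_decomposition nu P N) :
  charge_norm nu = fine (charge_variation nuPN [set: T]).
Proof.
have [eP eN] := Hahn_decomposition_uniq (hahn_posneg nu) nuPN measurableT.
rewrite /charge_norm /charge_variation /= !jordan_posE !jordan_negE.
rewrite !cjordan_posE !cjordan_negE /crestr0 mem_set// /crestr.
by rewrite eP eN.
Qed.

Definition charge_integral nu (f : T -> \bar R) : \bar R :=
  (\int[charge_pos nu]_x f x - \int[charge_neg nu]_x f x)%E.

Lemma charge_posnegE nu A : measurable A ->
  nu A = (charge_pos nu A - charge_neg nu A)%E.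
Proof.
by move=> mA; rewrite (jordan_decomp (hahn_posneg nu) mA) /cadd/= cscaleN1.
Qed.

Lemma charge_norm_ub nu A : measurable A -> (`|nu A| <= (charge_norm nu)%:E)%E.
Proof.
move=> mA; rewrite fineK ?fin_num_measure//.
apply: (le_trans (abse_charge_variation (hahn_posneg nu) mA)).
by apply: le_measure; rewrite ?inE.
Qed.

End charge_integral.

Section convolution_charge.
Context d (T : measurableAbGroupType d) (R : realType).
Implicit Types (V W : {charge set T -> \bar R}) (A : set T).

(* The set A - x. *)
Definition translate A (x : T) : set T := [set y | A (y + x)].

Lemma shift_xsection A x :
  translate A x = xsection [set z : T * T | A (z.2 + z.1)] x.
Proof. by apply/seteqP; split=> y; rewrite /xsection/= inE. Qed.

Lemma measurable_add :
  measurable_fun [set: T * T] (fun z : T * T => z.2 + z.1).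
Proof.
have mo : measurable_fun [set: T * T] (fun z : T * T => (0 - z.1 : T)).
  rewrite (_ : (fun z : T * T => _) =
    (fun w : T * T => w.1 - w.2) \o (fun z => (0, z.1))) //.
  apply: measurableT_comp; first exact: measurable_sub.
  by apply: measurable_fun_pair => //; exact: measurable_fst.
rewrite (_ : (fun z : T * T => _) =
  (fun w : T * T => w.1 - w.2) \o (fun z => (z.2, 0 - z.1))); last first.
  by apply/funext => z /=; rewrite sub0r opprK.
apply: measurableT_comp; first exact: measurable_sub.
by apply: measurable_fun_pair => //; exact: measurable_snd.
Qed.

Lemma measurable_add_preimage A : measurable A ->
  measurable [set z : T * T | A (z.2 + z.1)].
Proof. by move=> mA; rewrite -[X in measurable X]setTI; exact: measurable_add. Qed.

Lemma measurable_shift A x : measurable A -> measurable (translate A x).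
Proof.
move=> mA; rewrite shift_xsection; apply: measurable_xsection.
exact: measurable_add_preimage.
Qed.

Lemma measurable_fun_shift V A : measurable A ->
  measurable_fun [set: T] (fun x => V (translate A x)).
Proof.
move=> mA; rewrite (_ : (fun x => _) = (fun x =>
  charge_pos V (translate A x) - charge_neg V (translate A x))%E); last first.
  by apply/funext => x; apply: charge_posnegE; exact: measurable_shift.
under eq_fun do rewrite shift_xsection.
by apply: emeasurable_funB; apply: measurable_fun_xsection;
  exact: measurable_add_preimage.
Qed.

Let integrable_shift V A (mu : {finite_measure set T -> \bar R}) :
  measurable A -> mu.-integrable [set: T] (fun x => V (translate A x)).
Proof.
move=> mA; apply: (@le_integrable _ _ _ mu _ measurableT _ 
  (EFin \o cst (charge_norm V))) => //.
- exact: measurable_fun_shift.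
- move=> x _ /=; rewrite (le_trans (charge_norm_ub _ (measurable_shift _ _)))//.
  by rewrite lee_fin ler_norm.
- exact: finite_measure_integrable_cst.
Qed.

Let sigma_additive_shift V (mu : {finite_measure set T -> \bar R})
    (F : (set T)^nat) :
  (forall i, measurable (F i)) -> trivIset [set: nat] F ->
  (fun n => \sum_(0 <= i < n) \int[mu]_x V (translate (F i) x))%E @ \oo
    --> (\int[mu]_x V (translate (\bigcup_i F i) x))%E.
Proof.
move=> mF tF; have mU : measurable (\bigcup_i F i) by exact: bigcupT_measurable.
have tS x : trivIset [set: nat] (fun i => translate (F i) x).
  move/trivIsetP : tF => tF; apply/trivIsetP => i j _ _ ij.
  apply/seteqP; split=> // y [Fi Fj].
  by have : (F i `&` F j) (y + x) by []; rewrite tF.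
have sE x : translate (\bigcup_i F i) x = \bigcup_i translate (F i) x by [].
have -> : (fun n => \sum_(0 <= i < n) \int[mu]_x V (translate (F i) x))%E =
    (fun n => \int[mu]_x (\sum_(0 <= i < n) V (translate (F i) x)))%E.
  by apply/funext => n; rewrite integral_sum// => i; exact: integrable_shift.
have [|||||_ _] := @dominated_convergence _ _ _ mu _ measurableT
  (fun n x => \sum_(0 <= i < n) V (translate (F i) x))%E
  (fun x => V (translate (\bigcup_i F i) x)) (EFin \o cst (charge_norm V)).
- by move=> n; apply: emeasurable_sum => i; exact: measurable_fun_shift.
- exact: measurable_fun_shift.
- apply/aeW => x _; rewrite sE; apply: charge_semi_sigma_additive => //.
  + by move=> i; exact: measurable_shift.
  + by rewrite -sE; exact: measurable_shift.
- exact: finite_measure_integrable_cst.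
- apply/aeW => x n _; rewrite /= big_mkord.
  rewrite -(@charge_semi_additive _ _ _ V (fun i => translate (F i) x))//.
  + apply: charge_norm_ub; apply: bigsetU_measurable => i _.
    exact: measurable_shift.
  + by move=> i; exact: measurable_shift.
  + by apply: bigsetU_measurable => i _; exact: measurable_shift.
- by [].
Qed.

Definition convolution V W A : \bar R := charge_integral W (fun x => V (translate A x)).

Let conv0 V W : convolution V W set0 = 0%E.
Proof.
by rewrite /convolution /charge_integral; under eq_integral do rewrite charge0;
  under [X in (_ - X)%E]eq_integral do rewrite charge0; rewrite !integral0 sube0.
Qed.

Let conv_fin V W A : measurable A -> convolution V W A \is a fin_num.
Proof.
by move=> mA; rewrite fin_numB; apply/andP; split;
  apply: integrable_fin_num => //; exact: integrable_shift.
Qed.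

Let conv_sigma_additive V W : semi_sigma_additive (convolution V W).
Proof.
move=> F mF tF mUF; rewrite (_ : (fun n => _) = (fun n =>
  \sum_(0 <= i < n) \int[charge_pos W]_x V (translate (F i) x) -
  \sum_(0 <= i < n) \int[charge_neg W]_x V (translate (F i) x))%E); last first.
  apply/funext => n; rewrite -sumeN -?big_split// => i j _ _.
  by rewrite fin_num_adde_defl//; apply: integrable_fin_num => //;
    exact: integrable_shift.
apply: cvgeB.
- by rewrite fin_num_adde_defl// fin_numN; apply: integrable_fin_num => //;
    exact: integrable_shift.
- exact: sigma_additive_shift.
- exact: sigma_additive_shift.
Qed.

HB.instance Definition _ V W := isCharge.Build _ _ _ (convolution V W)
  (conv0 V W) (@conv_fin V W) (@conv_sigma_additive V W).

End convolution_charge.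

Section signed_measure_operations.
Context d (T : measurableAbGroupType d) (R : realType).
Local Notation M := (charge T R).

Definition chzero : M := czero.
Definition chadd (V W : M) : M := cadd V W.
Definition chsub (V W : M) : M := cadd V (copp W).
Definition chmul (V W : M) : M := convolution V W.
Definition chone : M := charge_of_finite_measure (\d_(0 : T)).
Definition chpow (V : M) (m : nat) : M := \big[chmul/chone]_(i < m) V.
Definition chprob (P : probability T R) : M := charge_of_finite_measure P.

End signed_measure_operations.

(* The argument of ln is at least 1 on the whole interval. *)
Definition c1 (R : realType) : R :=
  sup [set ln (2 - (1 - x) * expR x) / x ^+ 2 | x in `]0, +oo[ ].

Section expansion.
Context d (T : measurableAbGroupType d) (R : realType) (n : nat).
Variables (F : 'I_n -> probability T R) (G : probability T R).

Definition prod_distr : {charge set T -> \bar R} :=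
  \big[@chmul d T R/@chone d T R]_(j < n) chprob (F j).

Definition diffFG (j : 'I_n) := chsub (chprob (F j)) (chprob G).

Definition termV (k : nat) : {charge set T -> \bar R} :=
  \big[@chadd d T R/@chzero d T R]_(J : {set 'I_n} | #|J| == k)
    \big[@chmul d T R/@chone d T R]_(j in J) diffFG j.

Definition approxW (l : nat) : {charge set T -> \bar R} :=
  \big[@chadd d T R/@chzero d T R]_(k < l.+1)
    chmul (termV k) (chpow (chprob G) (n - k)).

Definition smoothM (j : 'I_n) (k : nat) :=
  chmul (diffFG j) (chpow (chprob G) ((n - k) %/ k)).

Definition nu (k m : nat) : R := \sum_(j < n) charge_norm (smoothM j k) ^+ m.

Definition nu_tilde (k : nat) : R :=
  charge_norm (\big[@chadd d T R/@chzero d T R]_(j < n) smoothM j k).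

(* All terms are nonnegative, so including 0 in the maximum only fixes the
   value of the maximum over the empty set. *)
Definition eta (l : nat) : R :=
  \big[Num.max/0]_(l.+1 <= k < n.+1)
    (k%:R^-1 * (nu_tilde k ^+ 2 / (4 * c1 R) + nu k 2)).

(* Equality of distributions: values of set functions outside the sigma-algebra
   are irrelevant. *)
Definition mean_distr : Prop :=
  forall A, measurable A -> G A = ((n%:R^-1)%:E * \sum_(j < n) F j A)%E.

End expansion.

Section constants.
Context (R : realType).

Definition admissible (l : nat) : set R :=
  [set u | forall d (T : measurableAbGroupType d) (n : nat)
      (F : 'I_n -> probability T R) (G : probability T R),
    (0 < n)%N -> (l <= n)%N ->
    charge_norm (chsub (prod_distr F) (approxW F G l)) <=
      u * eta F G 0 `^ (l.+1%:R / 2)].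

Definition admissible_mean (l : nat) : set R :=
  [set u | forall d (T : measurableAbGroupType d) (n : nat)
      (F : 'I_n -> probability T R) (G : probability T R),
    (0 < n)%N -> (l <= n)%N -> mean_distr F G ->
    charge_norm (chsub (prod_distr F) (approxW F G l)) <=
      u * eta F G 1 `^ (l.+1%:R / 2)].

Definition smallest_element (S : set R) (u : R) : Prop := S u /\ lbound S u.

Definition unique_positive_solution (E : R -> Prop) (x : R) : Prop :=
  [/\ 0 < x, E x & forall y, 0 < y -> E y -> y = x].

End constants.
Arguments admissible : clear implicits.
Arguments admissible_mean : clear implicits.

(* Main.v *)
Require Import Defs.
From HB Require Import structures.
From mathcomp Require Import all_boot all_order all_algebra.
From mathcomp Require Import all_classical all_reals all_analysis.
From mathcomp Require Import measurable_realfun ring lra.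
Import Order.TTheory GRing.Theory Num.Theory.
Import numFieldNormedType.Exports.

Set Implicit Arguments.
Unset Strict Implicit.
Unset Printing Implicit Defensive.

Local Open Scope classical_set_scope.
Local Open Scope ring_scope.

(** With [g] the law [G], [f_j] the laws [F_j] and [d_j = f_j - g], multiplying
    out [prod_j (g + d_j)] in the commutative convolution algebra gives
    [prod_j f_j - W_l = sum_(l < k <= n) e_k(d) g^(n-k)], where [e_k] is the
    [k]-th elementary symmetric polynomial.  As [e_k] is homogeneous, [k] times
    [(n - k) %/ k] of the powers of [g] can be moved inside, so that every term
    is at most the norm of [e_k(M_1, ..., M_n)], [M_j] being the smoothed
    differences of the statement.

    Kerstan's method bounds [e_k(M)].  It is the coefficient of [z^k] in
    [prod_j (1 + z M_j) = exp(z S) prod_j ((1 + z M_j) exp(- z M_j))], with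
    [S = sum_j M_j].  The power series of [(1 + x) exp(- x)] has the majorant
    [phi x = 2 - (1 - x) exp x], and [phi x <= exp(c1 x^2)] by definition of
    [c1]; this controls the product.  For [exp(z S)] it is enough to bound each
    coefficient separately, by [y^i / i! <= exp(y^2 / 4)]: the coefficients of
    the product already absorb the sum over [i].  Optimizing the radius gives
    that the [k]-th term is at most [x^k] with [x = (2 e c1 eta)^(1/2)]
    ([elem_sym_le], [kerstan_bound]).

    If [x] is small, the remainder is at most the geometric tail
    [x^(l+1) / (1 - x)]; otherwise it is at most [1] plus the norm of [W_l], that
    is [2 + x + ... + x^l].  Compared to [x^(l+1)] the first bound increases and
    the second one decreases with [x]; they agree at the point [x_l] of the
    statement ([crossover_le]).  If [G] is the mean of the [F_j] then [S = 0], the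
    term of order [1] disappears, and the crossover point changes accordingly.

    For the orders [1], [2], [3] of the mean case this is not sharp enough.  When
    [S = 0] the coefficients of [prod_j phi(m_j z)] up to degree [8] are dominated
    by those of [exp(a z^2 + b z^3)], where [a] and [b] are a half and a third of
    the sums of the [m_j^2] and [m_j^3] ([elem_sym_sum0_le]).  This improves the
    first terms of the tail ([mean_remainder1_le] and its companions).

    To work in an honest algebra, signed measures are identified when they agree
    on measurable sets; the classes form a commutative real algebra on which the
    total variation is a submultiplicative seminorm ([class_seminorm]).  The
    algebra laws reduce to Tonelli's theorem for finite measures.

    The smallest constants are infima: the admissible constants form a closed
    half-line, bounded below since [eta] is positive for some choice of the
    distributions ([admissible_ge0], [admissible_mean_ge0]). *)
(** * Inequalities for the exponential *)

Section scalar.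
Variable R : realType.
Implicit Types (x y : R) (k K : nat).

Lemma expR1_ge2 : 2 <= expR 1 :> R.
Proof. by apply: le_trans (expR_ge1Dx _); rewrite -natr1 addrC. Qed.

Lemma expR_ge_pow (w : R) j : 0 <= w -> (expR 1 * w / j.+1%:R) ^+ j.+1 <= expR w.
Proof.
move=> w0; have j0 : 0 < j.+1%:R :> R by [].
rewrite -[X in _ <= expR X](@divfK _ j.+1%:R) ?gt_eqF// expRM_natr.
rewrite lerXn2r ?nnegrE ?expR_ge0 ?mulr_ge0 ?expR_ge0//.
have := expR_ge1Dx (w / j.+1%:R - 1); rewrite addrC subrK expRD expRN => h.
rewrite -mulrA -ler_pdivlMl ?expR_gt0// [leRHS]mulrC; exact: h.
Qed.

(** After squaring, with [w = y^2 / 2], this is [(2 w)^j <= (j!)^2 exp w]: for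
    [j >= 4] it follows from [w^j / j! <= exp w] since then [2^j <= j!], for smaller
    [j] from [(e w / j)^j <= exp w]. *)
Lemma pow_fact_le_expR y j : 0 <= y -> y ^+ j / j`!%:R <= expR (y ^+ 2 / 4).
Proof.
move=> y0; rewrite -(@ler_pXn2r _ 2)// ?nnegrE ?expR_ge0 ?divr_ge0 ?exprn_ge0//.
rewrite -expRM_natr.
rewrite expr_div_n exprAC.
have -> : y ^+ 2 / 4 * 2 = y ^+ 2 / 2 by field.
have : 0 <= y ^+ 2 / 2 by rewrite divr_ge0 ?exprn_ge0.
have -> : (y ^+ 2) ^+ j = (y ^+ 2 / 2) ^+ j * 2 ^+ j.
  by rewrite -exprMn divfK.
move: (y ^+ 2 / 2) => w w0.
have e2 := expR1_ge2.
have hE m : (2 * w / m.+1%:R) ^+ m.+1 <= expR w.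
  apply: le_trans (expR_ge_pow m w0).
  by rewrite lerXn2r ?nnegrE ?divr_ge0 ?mulr_ge0 ?expR_ge0// ler_wpM2r// ler_wpM2r.
case: j => [|[|[|[|j]]]].
- by rewrite !expr0 fact0 expr1n divr1 mul1r -expR0 ler_expR.
- by have := hE 0%N; rewrite !expr1 (_ : 1`! = 1%N)// expr1n !divr1 mulrC.
- apply: le_trans (hE 1%N).
  by rewrite !factS fact0 !expr2; lra.
- apply: le_trans (hE 2%N).
  rewrite !factS fact0 -subr_ge0.
  rewrite [X in 0 <= X](_ : _ = w ^+ 3 * (2 / 27)); last by field.
  by rewrite mulr_ge0 ?exprn_ge0.
- have f0 m : 0 < m`!%:R :> R by rewrite ltr0n fact_gt0.
  apply: (@le_trans _ _ (w ^+ j.+4 / j.+4`!%:R)); last first.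
    by apply: le_trans (expR_ge1Dxn j.+3 w0); rewrite lerDr.
  rewrite -mulrA ler_wpM2l ?exprn_ge0// expr2 invfM mulrA.
  apply: ler_piMl; first by rewrite invr_ge0 ltW.
  rewrite ler_pdivrMr// mul1r -natrX ler_nat.
  elim: j => // j; rewrite expnS factS => ih.
  by apply: leq_mul.
Qed.

(** The majorant of the power series of [(1 + x) exp(- x)]. *)
Definition phi x := 2 - (1 - x) * expR x.

Lemma series_le_expR n x : 0 <= x -> \sum_(i < n) x ^+ i / i`!%:R <= expR x.
Proof.
move=> x0; rewrite -(big_mkord xpredT (fun i => x ^+ i / i`!%:R)) /expR.
have := @nondecreasing_cvgn_le _ (series (exp_coeff x)) _ (is_cvg_series_exp_coeff x) n.
apply; apply/nondecreasing_seqP => m.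
by rewrite /series/= big_nat_recr//= lerDl divr_ge0 ?exprn_ge0.
Qed.

(** The absolute value of the [k]-th coefficient of [(1 + x) exp(- x)]. *)
Definition kcoef k : R := if k is j.+1 then j%:R / k`!%:R else 1.

Lemma kcoef_ge0 k : 0 <= kcoef k.
Proof. by case: k => [|k]//=; rewrite divr_ge0. Qed.

Lemma series_kcoefE n x : series (fun i => kcoef i * x ^+ i) n.+1 =
  2 + x * series (exp_coeff x) n - series (exp_coeff x) n.+1.
Proof.
elim: n => [|n ih].
  by rewrite /series/= !big_nat1 big_geq// /exp_coeff/= !expr0 fact0; field.
have S u m : series u m.+1 = series u m + u m :> R.
  by rewrite /series/= big_nat_recr.
rewrite S ih (S _ n.+1) (S _ n) /exp_coeff/= factS natrM -(natr1 n) exprS.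
have f0 : n`!%:R != 0 :> R by rewrite pnatr_eq0 -lt0n fact_gt0.
have k0 : n%:R + 1 != 0 :> R by rewrite natr1 pnatr_eq0.
by field; rewrite f0 k0.
Qed.

Lemma series_kcoef_le_phi n x : 0 <= x -> \sum_(i < n) kcoef i * x ^+ i <= phi x.
Proof.
move=> x0; rewrite -(big_mkord xpredT (fun i => kcoef i * x ^+ i)).
have nd : nondecreasing_seq (series (fun i => kcoef i * x ^+ i)).
  apply/nondecreasing_seqP => m; rewrite /series/= big_nat_recr//= lerDl.
  by rewrite mulr_ge0 ?kcoef_ge0 ?exprn_ge0.
have cv : series (fun i => kcoef i * x ^+ i) @ \oo --> phi x.
  rewrite -(cvg_shiftS (series _)) (_ : [sequence _]_n = fun n =>
    2 + x * series (exp_coeff x) n - series (exp_coeff x) n.+1); last first.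
    by apply/funext => m; rewrite -series_kcoefE.
  have -> : phi x = 2 + x * expR x - expR x by rewrite /phi; ring.
  have c := is_cvg_series_exp_coeff x.
  apply: cvgB; first by apply: cvgD; [exact: cvg_cst | apply: cvgMr].
  by rewrite (cvg_shiftS (series _)).
by have := @nondecreasing_cvgn_le _ _ nd (cvgP _ cv) n; rewrite (cvg_lim _ cv).
Qed.

End scalar.

(** * The constant of the Kerstan majorant *)

Section numeric.
Variable R : realType.
Implicit Types (x t : R).

(** Each remainder term [2 x^m / m!] dominates the next term of the series plus the
    next remainder term, so the right-hand side decreases with [n]. *)
Lemma expR_le_series n x : 0 <= x <= 1 ->
  expR x <= \sum_(i < n.+1) x ^+ i / i`!%:R + 2 * (x ^+ n.+1 / n.+1`!%:R).
Proof.
move=> /andP[x0 x1].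
pose u m : R := series (exp_coeff x) m.+1 + 2 * (x ^+ m.+1 / m.+1`!%:R).
have t0 m : 0 <= x ^+ m / m`!%:R by rewrite divr_ge0 ?exprn_ge0.
have uS m : u m.+1 <= u m.
  rewrite /u [series _ m.+2](_ : _ = series (exp_coeff x) m.+1 + x ^+ m.+1 / m.+1`!%:R).
    rewrite -addrA lerD2l.
    suff : 2 * (x ^+ m.+2 / m.+2`!%:R) <= x ^+ m.+1 / m.+1`!%:R by move: (t0 m.+1); lra.
    rewrite [m.+2`!]factS natrM exprS invfM mulrACA [2 * _]mulrA.
    apply: ler_piMl; first exact: t0.
    rewrite mulrA ler_pdivrMr// mul1r.
    apply: (@le_trans _ _ 2); last by rewrite ler_nat.
    by rewrite ler_piMr.
  by rewrite /series/= big_nat_recr.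
have un m : (n <= m)%N -> u m <= u n.
  by elim: m => [|m ih]; rewrite leq_eqVlt => /orP[/eqP<-//|//]; move=> /ih; apply: le_trans.
rewrite -(big_mkord xpredT (fun i => x ^+ i / i`!%:R)) -/(u n) /expR.
apply: limr_le; first exact: is_cvg_series_exp_coeff.
near=> m; have nm : (n < m)%N by near: m; exists n.+1.
rewrite -(prednK (leq_ltn_trans (leq0n n) nm)).
apply: le_trans (un m.-1 _); last by rewrite -ltnS (ltn_predK nm).
by rewrite /u lerDl mulr_ge0.
Unshelve. all: by end_near. Qed.

Lemma expR1_le : expR 1 <= 193 / 71 :> R.
Proof.
apply: le_trans (expR_le_series 7 _) _; first by rewrite ler01 lexx.
rewrite !big_ord_recl big_ord0/= !expr1n.
rewrite /bump/= !add1n !factS fact0 !natrM; lra.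
Qed.

(** This quintic has a minimum of about [1 / 4000] near [t = 0.06].  Written as
    [1/510 - 223/4000 t + K t^2], where [K] decreases in [t], it is handled by
    constant lower bounds of [K] on three intervals; on the first one the
    resulting quadratic has a negative discriminant. *)
Lemma quintic_ge0 t : 0 <= t <= 1 ->
  0 <= 1/510 - 223/4000 * t + 191/400 * t^+2 - 417/1000*t^+3 + 281/1000*t^+4 - 132/1000*t^+5.
Proof.
move=> /andP[t0 t1].
have t2 : 0 <= t ^+ 2 by rewrite exprn_ge0.
set K := 191/400 - 417/1000*t + 281/1000*t^+2 - 132/1000*t^+3.
rewrite [leRHS](_ : _ = 1/510 - 223/4000 * t + K * t^+2); last by rewrite /K; ring.
have KE : K = 191/400 - 417/1000*t + 281/1000*t^+2 - 132/1000*t^+3 by [].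
case: (leP t (19/100)) => h1.
  have K1 : 407/1000 <= K.
    have : 0 <= t^+2 * (19/100 - t) by rewrite mulr_ge0// subr_ge0.
    have : 0 <= (19/100 - t)^+2 by rewrite sqr_ge0.
    by rewrite KE; lra.
  have : 407/1000 * t^+2 <= K * t^+2 by rewrite ler_wpM2r.
  have : 0 <= (t - 137/2000)^+2 by rewrite sqr_ge0.
  lra.
have ht : 0 <= (t - 19/100) * t by rewrite mulr_ge0// subr_ge0 ltW.
case: (leP t (4/10)) => h2.
  have K1 : 1/3 <= K.
    have : 0 <= t^+2 * (4/10 - t) by rewrite mulr_ge0// subr_ge0.
    have : 0 <= (4/10 - t)^+2 by rewrite sqr_ge0.
    by rewrite KE; lra.
  have : 1/3 * t^+2 <= K * t^+2 by rewrite ler_wpM2r.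
  lra.
have ht' : 0 <= (t - 4/10) * t by rewrite mulr_ge0// subr_ge0 ltW.
have K1 : 2/10 <= K.
  have : 0 <= t^+2 * (1 - t) by rewrite mulr_ge0// subr_ge0.
  have : 0 <= (1 - t)^+2 by rewrite sqr_ge0.
  by rewrite KE; lra.
have : 2/10 * t^+2 <= K * t^+2 by rewrite ler_wpM2r.
lra.
Qed.

(** The polynomial is divisible by [(1 - t)^2], and the quotient dominates the
    quintic of [quintic_ge0], obtained by rounding down its first coefficients. *)
Lemma phi_expR_poly t : 0 <= t <= 1 ->
  0 <= (\sum_(i < 6) (84 / 121 * (1 - t) ^+ 2) ^+ i / i`!%:R +
        t * (\sum_(i < 7) (1 - t) ^+ i / i`!%:R)) - 2.
Proof.
move=> t01; have /andP[t0 t1] := t01.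
have := quintic_ge0 t01.
have p j : 0 <= (1 - t)^+2 * t ^+ j by rewrite mulr_ge0// ?exprn_ge0// subr_ge0.
have p' j : 0 <= (1 - t)^+2 * (t ^+ j * (1 - t)) by rewrite !mulr_ge0// ?exprn_ge0// subr_ge0.
move=> /(mulr_ge0 (exprn_ge0 2 (_ : 0 <= 1 - t))); rewrite subr_ge0 => /(_ t1).
have := p 0; have := p 1%N; have := p 2%N; have := p 8%N.
have := p' 2%N; have := p' 3%N; have := p' 4%N; have := p' 5%N.
have := p' 6%N; have := p' 7%N.
rewrite !big_ord_recl !big_ord0/=; rewrite /bump/= !add1n !factS fact0 !natrM.
lra.
Qed.

Lemma expRN_le_quadratic t : 0 <= t -> expR (- t) <= 1 - t + t ^+ 2 / 2.
Proof.
move=> t0; have t2 : 0 <= t ^+ 2 by rewrite exprn_ge0.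
have et : 1 + t + t ^+ 2 / 2 <= expR t.
  apply: le_trans (series_le_expR 3 t0).
  by rewrite !big_ord_recl big_ord0/=; rewrite /bump/= !add1n !factS fact0; lra.
have h2 : 0 <= 1 - t + t ^+ 2 / 2 by nra.
rewrite expRN -[leLHS]mul1r ler_pdivrMr ?expR_gt0//.
apply: le_trans (ler_wpM2l h2 et).
rewrite -subr_ge0 [leRHS](_ : _ = t ^+ 4 / 4); last by field.
by rewrite divr_ge0 ?exprn_ge0.
Qed.

(** The best constant in place of [84 / 121] is [c1], which exceeds
    [84 / 121 - 2 / 10000]; the two sides nearly touch around [x = 0.96].  On the
    interval from [0] to [1] both exponentials are replaced by partial sums, and [x = 1 - t] leads to
    [phi_expR_poly].  For [x = 1 + t] there is room: after multiplication by
    [exp(- t)] crude bounds suffice. *)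
Lemma phi_le_expR x : 0 <= x -> phi x <= expR (84 / 121 * x ^+ 2).
Proof.
move=> x0; case: (leP x 1) => x1; last first.
  have -> : x = 1 + (x - 1) by ring.
  have : 0 < x - 1 by rewrite subr_gt0.
  move: (x - 1) => t t0 {x x0 x1}; rewrite /phi.
  rewrite -(@ler_pM2r _ (expR (- t))) ?expR_gt0// -expRD.
  rewrite [leLHS](_ : _ = 2 * expR (- t) + t * expR 1); last first.
    rewrite expRD mulrBl -!mulrA -[expR t * _]expRD subrr expR0; ring.
  have -> : 84 / 121 * (1 + t) ^+ 2 - t =
    84 / 121 + (47 / 121 * t + 84 / 121 * t ^+ 2) by field.
  rewrite expRD.
  have e1 := expR1_le.
  have ec : 2001 / 1000 <= expR (84 / 121) :> R.
    apply: le_trans (series_le_expR 6 _); last by lra.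
    rewrite !big_ord_recl big_ord0/=; rewrite /bump/= !add1n !factS fact0 !natrM; lra.
  have et := expRN_le_quadratic (ltW t0).
  have eu := expR_ge1Dx (47 / 121 * t + 84 / 121 * t ^+ 2).
  have t2 : 0 <= t ^+ 2 by rewrite exprn_ge0// ltW.
  apply: (@le_trans _ _ (2001 / 1000 * (1 + (47 / 121 * t + 84 / 121 * t ^+ 2)))); last first.
    apply: (ler_pM _ _ ec eu); first by rewrite divr_ge0 ?ler0n.
    by rewrite addr_ge0 ?ler01 ?addr_ge0 ?mulr_ge0 ?divr_ge0 ?ler0n ?(ltW t0).
  have et2 : t * expR 1 <= t * (193 / 71) by rewrite ler_wpM2l// ltW.
  have t4 := exprn_ge0 4 (ltW t0); lra.
rewrite /phi lerBlDr.
apply: (@le_trans _ _ (\sum_(i < 6) (84 / 121 * x ^+ 2) ^+ i / i`!%:R +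
    (1 - x) * \sum_(i < 7) x ^+ i / i`!%:R)); last first.
  apply: lerD.
    by apply: series_le_expR; rewrite mulr_ge0 ?exprn_ge0.
  by rewrite ler_wpM2l ?subr_ge0// series_le_expR.
have -> : x = 1 - (1 - x) by ring.
have t0 : 0 <= 1 - x by rewrite subr_ge0.
have t1 : 1 - x <= 1 by lra.
move: (1 - x) t0 t1 => t t0 t1 {x x0 x1}.
rewrite -subr_ge0 (_ : 1 - (1 - t) = t); last by ring.
by apply: phi_expR_poly; rewrite t0.
Qed.

End numeric.

Section c1.
Variable R : realType.
Implicit Types (x : R).

Lemma phi_ge1 x : 0 <= x -> 1 <= phi x.
Proof.
move=> x0; apply: le_trans (series_kcoef_le_phi 1 x0).
by rewrite big_ord_recl big_ord0/= mulr1 addr0.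
Qed.

Let c1_set : set R := [set ln (2 - (1 - x) * expR x) / x ^+ 2 | x in `]0, +oo[ ].

Let ub_c1 : ubound c1_set (84 / 121).
Proof.
move=> _ [x + <-]; rewrite /= in_itv/= andbT => x0; rewrite -/(phi x).
rewrite ler_pdivrMr ?exprn_gt0// -(expRK (_ * _)) ler_ln ?posrE ?expR_gt0//.
  by rewrite phi_le_expR ?ltW.
by rewrite (lt_le_trans ltr01)// phi_ge1 ?ltW.
Qed.

Lemma c1_le : c1 R <= 84 / 121.
Proof.
apply: ge_sup => //; exists (ln (phi 1) / 1 ^+ 2); exists 1 => //=.
by rewrite in_itv/= ltr01.
Qed.

Let le_c1 x : 0 < x -> ln (phi x) / x ^+ 2 <= c1 R.
Proof.
move=> x0; apply: ub_le_sup; first by exists (84 / 121).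
by exists x => //=; rewrite in_itv/= x0.
Qed.

Lemma c1_gt0 : 0 < c1 R.
Proof.
apply: lt_le_trans (le_c1 ltr01); rewrite expr1n divr1 /phi subrr mul0r subr0.
by rewrite ln_gt0// ltr1n.
Qed.

Lemma phi_le_c1 x : 0 <= x -> phi x <= expR (c1 R * x ^+ 2).
Proof.
rewrite le_eqVlt => /predU1P[<-|x0].
  by rewrite /phi expR0 expr0n mulr0 expR0; lra.
have px : 0 < phi x by rewrite (lt_le_trans ltr01)// phi_ge1 ?ltW.
rewrite -[leLHS](lnK px) ler_expR -ler_pdivrMr ?exprn_gt0//; exact: le_c1.
Qed.

(** The square root of [2 e c1], so that [x = kappa * Num.sqrt eta]. *)
Definition kappa : R := Num.sqrt (2 * expR 1 * c1 R).

Lemma kappa_gt0 : 0 < kappa.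
Proof. by rewrite sqrtr_gt0 !mulr_gt0 ?expR_gt0// c1_gt0. Qed.

Lemma kappa_sqr : kappa ^+ 2 = 2 * expR 1 * c1 R.
Proof. by rewrite sqr_sqrtr// !mulr_ge0 ?expR_ge0// ltW// c1_gt0. Qed.

Lemma kappa_sqr_le : kappa ^+ 2 <= 117 / 31.
Proof.
have e0 := expR_ge0 (1 : R); have c0 := ltW c1_gt0.
rewrite kappa_sqr -mulrA; apply: (@le_trans _ _ (2 * (193 / 71 * (84 / 121)))).
  rewrite ler_wpM2l//; exact: (ler_pM e0 c0 (expR1_le R) c1_le).
lra.
Qed.

Lemma kappa_le : kappa <= 1943 / 1000.
Proof.
have r0 : 0 <= 1943 / 1000 :> R by rewrite divr_ge0 ?ler0n.
rewrite -(@ler_pXn2r _ 2) ?nnegrE ?r0 ?(ltW kappa_gt0) ?lexx ?ltn0Sn//.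
apply: le_trans kappa_sqr_le _; lra.
Qed.

Lemma powR_half (a : R) k : 0 <= a -> a `^ (k%:R / 2) = Num.sqrt a ^+ k.
Proof.
move=> a0; rewrite mulrC powRrM powR12_sqrt// powR_mulrn//.
Qed.

End c1.

(** * Where the tail and the head of the expansion meet *)

Section geometric.
Variable R : realType.
Implicit Types (x D : R).

Lemma sum_exprE x m n : (m <= n)%N ->
  (\sum_(m <= k < n) x ^+ k) * (1 - x) = x ^+ m - x ^+ n.
Proof.
elim: n => [|n ih]; first by rewrite leqn0 => /eqP ->; rewrite big_geq// mul0r subrr.
rewrite leq_eqVlt => /predU1P[->|]; first by rewrite big_geq// mul0r subrr.
by rewrite ltnS => mn; rewrite big_nat_recr//= mulrDl ih// exprS; ring.
Qed.

Lemma sum_expr_le x m n : 0 <= x < 1 ->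
  \sum_(m <= k < n) x ^+ k <= x ^+ m / (1 - x).
Proof.
move=> /andP[x0 x1]; have x1' : 0 < 1 - x by rewrite subr_gt0.
rewrite ler_pdivlMr//.
have [mn|nm] := leqP m n; last first.
  by rewrite big_geq ?(ltnW nm)// mul0r exprn_ge0.
by rewrite sum_exprE// gerBl exprn_ge0.
Qed.

(** Up to [xl] the tail is used and from [xl] on the head.  The equation for [xl] says
    that the two bounds agree there, and [(x / xl)^(l+1) >= (x / xl)^k] for
    [k <= l + 1] transports the bound by the head from [xl] to larger [x].  The terms
    of the head start at order [m]: [1] in general, [2] when [G] is the mean. *)
Lemma crossover_le D x xl l m n : (0 < m <= l.+1)%N ->
  0 < xl < 1 -> 2 * (1 - xl) + xl ^+ m = 2 * xl ^+ l.+1 -> 0 <= x ->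
  D <= \sum_(l.+1 <= k < n) x ^+ k -> D <= 2 + \sum_(m <= k < l.+1) x ^+ k ->
  D <= x ^+ l.+1 / (1 - xl).
Proof.
move=> /andP[m0 ml] /andP[xl0 xl1] xlE x0 D1 D2.
have xl1' : 0 < 1 - xl by rewrite subr_gt0.
have [xxl|xlx] := leP x xl.
  apply: le_trans D1 _; apply: le_trans (sum_expr_le _ _ _) _.
    by rewrite x0 (le_lt_trans xxl).
  rewrite ler_wpM2l ?exprn_ge0// lef_pV2 ?posrE// ?subr_gt0 ?(le_lt_trans xxl)//.
  by rewrite lerD2l lerN2.
apply: le_trans D2 _; rewrite ler_pdivlMr//.
have h : (2 + \sum_(m <= k < l.+1) xl ^+ k) * (1 - xl) = xl ^+ l.+1.
  by rewrite mulrDl sum_exprE//; lra.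
have xlp : 0 < xl ^+ l.+1 by rewrite exprn_gt0.
have hk k : (k <= l.+1)%N -> x ^+ k * xl ^+ l.+1 <= x ^+ l.+1 * xl ^+ k.
  move=> kl; rewrite -(subnKC kl) !exprD [x ^+ k * _ * _]mulrAC mulrA.
  rewrite ler_wpM2l ?mulr_ge0 ?exprn_ge0// ?(ltW xl0)//.
  by rewrite lerXn2r ?nnegrE// ltW.
rewrite -(@ler_pM2r _ (xl ^+ l.+1))// -{2}h mulrAC mulrA ler_pM2r//.
rewrite mulrDl mulrDr; apply: lerD.
  by have := hk 0%N isT; rewrite !expr0; lra.
rewrite mulr_suml mulr_sumr big_nat [leRHS]big_nat; apply: ler_sum => k /andP[_ kl].
exact/hk/ltnW.
Qed.

End geometric.

Section crossover_points.
Variable R : realType.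
Implicit Types (x y : R).

Lemma crossover_point_ex l : exists x : R,
  unique_positive_solution (fun y => y ^+ l.+1 + y / 2 = 1) x /\ x < 1.
Proof.
pose p : {poly R} := 'X ^+ l.+1 + 2^-1 *: 'X - 1.
have pE y : p.[y] = y ^+ l.+1 + y / 2 - 1.
  by rewrite !hornerE mulrC.
have [||x /andP[x_ge0 x_le1] /rootP] := @poly_ivt _ p 0 1.
- exact: ler01.
- by rewrite !pE expr0n expr1n/=; lra.
rewrite pE => px.
have xE : x ^+ l.+1 + x / 2 = 1 by lra.
have x0 : 0 < x.
  rewrite lt_neqAle x_ge0 andbT; apply/eqP => x0; move: xE.
  by rewrite -x0 expr0n/=; lra.
have x1 : x < 1.
  rewrite lt_neqAle x_le1 andbT; apply/eqP => x1; move: xE.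
  by rewrite x1 expr1n; lra.
exists x; split=> //; split=> // y y0 yE.
apply/eqP; rewrite eq_le; apply/andP; split; rewrite leNgt; apply/negP => h.
  by have := ltrXn2r l.+1 (ltW x0) h; rewrite /=; lra.
by have := ltrXn2r l.+1 (ltW y0) h; rewrite /=; lra.
Qed.

Lemma crossover_point_mean_ex l : (0 < l)%N -> exists x : R,
  unique_positive_solution (fun y => y ^+ l.+1 - y ^+ 2 / 2 + y = 1) x /\ x < 1.
Proof.
move=> l0.
pose p : {poly R} := 'X ^+ l.+1 - 2^-1 *: 'X ^+ 2 + 'X - 1.
have pE y : p.[y] = y ^+ l.+1 - y ^+ 2 / 2 + y - 1.
  by rewrite !hornerE /= -mulrA -expr2 [2^-1 * _]mulrC.
have [||x /andP[x_ge0 x_le1] /rootP] := @poly_ivt _ p 0 1.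
- exact: ler01.
- by rewrite !pE !expr0n !expr1n/=; lra.
rewrite pE => px.
have xE : x ^+ l.+1 - x ^+ 2 / 2 + x = 1 by lra.
have x0 : 0 < x.
  rewrite lt_neqAle x_ge0 andbT; apply/eqP => x0; move: xE.
  by rewrite -x0 !expr0n/=; lra.
have lt1 y : 0 < y -> y ^+ l.+1 - y ^+ 2 / 2 + y = 1 -> y < 1.
  move=> y0 yE; rewrite ltNge; apply/negP => y1.
  have : y ^+ 2 <= y ^+ l.+1 by rewrite ler_weXn2l.
  by have := exprn_gt0 2 y0; lra.
have x1 := lt1 _ x0 xE.
exists x; split=> //; split=> // y y0 yE; have y1 := lt1 _ y0 yE.
apply/eqP; rewrite eq_le; apply/andP; split; rewrite leNgt; apply/negP => h.
  have := ltrXn2r l.+1 (ltW x0) h; rewrite /=.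
  have : 0 < (y - x) * (2 - (x + y)) by rewrite mulr_gt0; lra.
  lra.
have := ltrXn2r l.+1 (ltW y0) h; rewrite /=.
have : 0 < (x - y) * (2 - (x + y)) by rewrite mulr_gt0; lra.
lra.
Qed.

Lemma crossover_point_le l x y : x ^+ l.+1 + x / 2 = 1 -> 0 < y ->
  1 <= y ^+ l.+1 + y / 2 -> x <= y.
Proof.
move=> xE y0 yE; rewrite leNgt; apply/negP => h.
by have := ltrXn2r l.+1 (ltW y0) h; rewrite /=; lra.
Qed.

(** The solution [x] lies below every [y] at which the left-hand side of its
    equation reaches [1], so a rational [y] just above [x] gives explicit bounds. *)
Lemma kappa_div_le l x (y b : R) : x ^+ l.+1 + x / 2 = 1 -> 0 < y < 1 ->
  1 <= y ^+ l.+1 + y / 2 -> kappa R ^+ l.+1 <= b * (1 - y) ->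
  kappa R ^+ l.+1 / (1 - x) <= b.
Proof.
move=> xE /andP[y0 y1] yE kb; have xy := crossover_point_le xE y0 yE.
have k0 : 0 <= kappa R ^+ l.+1 by rewrite exprn_ge0// ltW// kappa_gt0.
have b0 : 0 <= b.
  by rewrite -(@pmulr_lge0 _ (1 - y)) ?subr_gt0// (le_trans k0).
rewrite ler_pdivrMr; last by rewrite subr_gt0 (le_lt_trans xy).
by apply: (le_trans kb); apply: ler_wpM2l => //; lra.
Qed.

Lemma kappa_small_bounds x : [/\ x ^+ 1 + x / 2 = 1 -> kappa R ^+ 1 / (1 - x) <= 59 / 10,
  x ^+ 2 + x / 2 = 1 -> kappa R ^+ 2 / (1 - x) <= 173 / 10,
  x ^+ 3 + x / 2 = 1 -> kappa R ^+ 3 / (1 - x) <= 445 / 10 &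
  x ^+ 4 + x / 2 = 1 -> kappa R ^+ 4 / (1 - x) <= 1075 / 10].
Proof.
have k0 := ltW (kappa_gt0 R); have k1 := kappa_le R; have k2 := kappa_sqr_le R.
have k2' : 0 <= kappa R ^+ 2 by rewrite exprn_ge0.
split=> xE.
- apply: (kappa_div_le (y := 2 / 3) xE); lra.
- apply: (kappa_div_le (y := 488 / 625) xE); lra.
- apply: (kappa_div_le (y := 522 / 625) xE); [lra|lra|].
  have := ler_pM k2' k0 k2 k1; rewrite -exprSr => h; apply: le_trans h _; lra.
- apply: (kappa_div_le (y := 491 / 566) xE); [lra|lra|].
  have := ler_pM k2' k2' k2 k2; rewrite -exprD => h; apply: le_trans h _; lra.
Qed.

End crossover_points.

(** * Small orders in the mean case *)

Section exp23.
Variable R : realType.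
Implicit Types (a b s m : R) (k : nat).

(** The coefficients of [z^0, ..., z^8] in [exp(a z^2 + b z^3)]. *)
Definition exp23_coef (a b : R) : seq R :=
  [:: 1; 0; a; b; a ^+ 2 / 2; a * b; a ^+ 3 / 6 + b ^+ 2 / 2; a ^+ 2 * b / 2;
      a ^+ 4 / 24 + a * b ^+ 2 / 2].

Lemma exp23_coef_ge0 a b k : 0 <= a -> 0 <= b -> 0 <= (exp23_coef a b)`_k.
Proof.
move=> a0 b0; do 9 (case: k => [|k];
  first by rewrite /= ?addr_ge0 ?mulr_ge0 ?exprn_ge0 ?mulr_ge0).
by rewrite nth_default.
Qed.

Lemma exp23_coef_le a b a' b' k : 0 <= a -> 0 <= b -> a <= a' -> b <= b' ->
  (exp23_coef a b)`_k <= (exp23_coef a' b')`_k.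
Proof.
move=> a0 b0 aa' bb'; have a'0 := le_trans a0 aa'; have b'0 := le_trans b0 bb'.
have X n x y : 0 <= x -> x <= y -> x ^+ n <= y ^+ n :> R.
  by move=> x0 xy; rewrite lerXn2r ?nnegrE// (le_trans x0).
do 9 (case: k => [|k]; first by rewrite /=;
  repeat first [done | apply: lerD | apply: ler_pM | apply: X
               | by rewrite ?mulr_ge0 ?exprn_ge0 ?mulr_ge0]).
by rewrite !nth_default.
Qed.

Lemma exp23_coef_homog a b s k :
  (exp23_coef (a * s ^+ 2) (b * s ^+ 3))`_k = (exp23_coef a b)`_k * s ^+ k.
Proof.
do 9 (case: k => [|k]; first by rewrite /=; field).
by rewrite !nth_default// mul0r.
Qed.

Lemma exp23_coefD a b a' b' k : (k <= 8)%N ->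
  \sum_(i < k.+1) (exp23_coef a b)`_i * (exp23_coef a' b')`_(k - i) =
  (exp23_coef (a + a') (b + b'))`_k.
Proof.
do 9 (case: k => [_|k]; first by rewrite !big_ord_recl big_ord0/=; field).
by [].
Qed.

(** [phi x] and [exp(x^2 / 2 + x^3 / 3)] agree up to order [4]; beyond it, the
    second series has the larger coefficients. *)
Lemma kcoef_le_exp23 m k : 0 <= m -> (k <= 8)%N ->
  kcoef R k * m ^+ k <= (exp23_coef (m ^+ 2 / 2) (m ^+ 3 / 3))`_k.
Proof.
move=> m0 k8; rewrite ![_ / _ in leRHS]mulrC exp23_coef_homog.
apply: ler_wpM2r; first by rewrite exprn_ge0.
move: k8; rewrite /kcoef.
do 9 (case: k => [_|k]; first by rewrite ?factS ?fact0/=; lra).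
by [].
Qed.

End exp23.

Section small_orders.
Variable R : realType.
Implicit Types (a : nat -> R) (s D : R) (n : nat).

(** What is known of the norms [a k] of the terms in the mean case, [s] being the
    square root of [eta].  The parameter [r] allows rational upper bounds of the
    square root of [k]. *)
Definition mean_bounds a s : Prop := [/\ 0 <= s,
  forall k (r : R), (2 <= k <= 8)%N -> 0 <= r -> k%:R <= r ^+ 2 ->
    a k <= (exp23_coef (2^-1) (3^-1))`_k * (r * s) ^+ k &
  forall k, (2 <= k)%N -> a k <= (kappa R * s) ^+ k].

(** As [k >= 2], a bound of order [s^k] is one of order [s^2] on bounded intervals. *)
Lemma mean_term_le a s k (r S c : R) : mean_bounds a s ->
  (2 <= k <= 8)%N -> 0 <= r -> k%:R <= r ^+ 2 ->
  s <= S -> (exp23_coef (2^-1) (3^-1))`_k * r ^+ k * S ^+ (k - 2) <= c ->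
  a k <= c * s ^+ 2.
Proof.
move=> [s0 a_small _] k28 r0 kr sS cE; apply: le_trans (a_small _ _ k28 r0 kr) _.
have /andP[k2 k8] := k28.
rewrite exprMn [s ^+ k](_ : _ = s ^+ (k - 2) * s ^+ 2); last by rewrite -exprD subnK.
rewrite 2![_ * (_ * _)]mulrA.
have h := ler_wpM2r (exprn_ge0 2 s0) cE; apply: le_trans h.
apply: ler_wpM2r; first exact: exprn_ge0.
have E0 : 0 <= (exp23_coef (2^-1 : R) (3^-1))`_k.
  by rewrite exp23_coef_ge0 ?invr_ge0 ?ler0n.
apply: ler_wpM2l; first by rewrite mulr_ge0 ?exprn_ge0.
by rewrite lerXn2r ?nnegrE// (le_trans s0).
Qed.

Lemma mean_tail_le a s m n X : mean_bounds a s -> (2 <= m)%N -> kappa R * s <= X -> X < 1 ->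
  \sum_(m <= k < n) a k <= (kappa R * s) ^+ m / (1 - X).
Proof.
move=> [s0 _ a_large] m2.
have : 0 <= kappa R * s by rewrite mulr_ge0// ltW// kappa_gt0.
move: (kappa R * s) a_large => x a_large x0 xX X1.
apply: (@le_trans _ _ (\sum_(m <= k < n) x ^+ k)).
  rewrite big_nat [leRHS]big_nat; apply: ler_sum => k /andP[mk _].
  exact/a_large/(leq_trans m2).
apply: (le_trans (sum_expr_le _ _ _)); first by rewrite x0 (le_lt_trans xX).
rewrite ler_wpM2l ?exprn_ge0// lef_pV2 ?posrE ?subr_gt0// ?(le_lt_trans xX)//.
by rewrite lerD2l lerN2.
Qed.

Lemma kappaM_le s S : 0 <= s -> s <= S -> kappa R * s <= 1943 / 1000 * S.
Proof. by move=> s0; apply: ler_pM (ltW (kappa_gt0 R)) s0 (kappa_le R). Qed.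

(** Beyond [s = 0.428] the trivial bound [2] suffices.  Below it, the terms of orders
    [2] to [8] are estimated by [exp23_coef] and the rest by a geometric series; the
    eight constants add up to [10.911]. *)
Lemma mean_remainder1_le a s D n : mean_bounds a s -> (9 <= n)%N ->
  D <= \sum_(2 <= k < n) a k -> D <= 2 -> D <= 1094 / 100 * s ^+ 2.
Proof.
move=> ab n9 D_sum D2; have s0 : 0 <= s by case: ab.
have [sS|Ss] := leP s (428 / 1000); last first.
  apply: (le_trans D2).
  have h : (428 / 1000) ^+ 2 <= s ^+ 2.
    by apply: lerXn2r; rewrite ?nnegrE ?divr_ge0 ?ler0n// ltW.
  move: h; clear; lra.
have x0 : 0 <= kappa R * s by rewrite mulr_ge0// ltW// kappa_gt0.
have xX : kappa R * s <= 8317 / 10000 by apply: (le_trans (kappaM_le s0 sS)); clear; lra.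
have A9 : \sum_(9 <= k < n) a k <= 62 / 10 * s ^+ 2.
  apply: (le_trans (@mean_tail_le _ _ 9 n _ ab isT xX _)); first by clear; lra.
  have x7 : (kappa R * s) ^+ 7 <= (8317 / 10000) ^+ 7.
    by apply: lerXn2r; rewrite ?nnegrE ?divr_ge0 ?ler0n.
  have x2 : (kappa R * s) ^+ 2 <= 117 / 31 * s ^+ 2.
    by rewrite exprMn ler_wpM2r ?exprn_ge0 ?kappa_sqr_le.
  have X1 : 0 < 1 - 8317 / 10000 :> R by clear; lra.
  have xE : (kappa R * s) ^+ 9 = (kappa R * s) ^+ 7 * (kappa R * s) ^+ 2 by rewrite -exprD.
  rewrite ler_pdivrMr ?X1// xE.
  have := ler_pM (exprn_ge0 7 x0) (exprn_ge0 2 x0) x7 x2.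
  move=> h; apply: (le_trans h); rewrite [leLHS]mulrA [leRHS]mulrAC.
  by apply: ler_wpM2r; [exact: exprn_ge0 | clear; lra].
have A2 : a 2%N <= 1002 / 1000 * s ^+ 2.
  apply: (@mean_term_le _ _ 2 (1415 / 1000) _ _ ab isT _ _ sS) => /=; clear; lra.
have A3 : a 3%N <= 743 / 1000 * s ^+ 2.
  apply: (@mean_term_le _ _ 3 (1733 / 1000) _ _ ab isT _ _ sS) => /=; clear; lra.
have A4 : a 4%N <= 367 / 1000 * s ^+ 2.
  apply: (@mean_term_le _ _ 4 2 _ _ ab isT _ _ sS) => /=; clear; lra.
have A5 : a 5%N <= 733 / 1000 * s ^+ 2.
  apply: (@mean_term_le _ _ 5 (2237 / 1000) _ _ ab isT _ _ sS) => /=; clear; lra.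
have A6 : a 6%N <= 555 / 1000 * s ^+ 2.
  apply: (@mean_term_le _ _ 6 (245 / 100) _ _ ab isT _ _ sS) => /=; clear; lra.
have A7 : a 7%N <= 544 / 1000 * s ^+ 2.
  apply: (@mean_term_le _ _ 7 (2646 / 1000) _ _ ab isT _ _ sS) => /=; clear; lra.
have A8 : a 8%N <= 767 / 1000 * s ^+ 2.
  apply: (@mean_term_le _ _ 8 (2829 / 1000) _ _ ab isT _ _ sS) => /=; clear; lra.
apply: (le_trans D_sum); rewrite (@big_cat_nat _ _ _ 9)//=.
do 7 rewrite big_ltn//; rewrite big_geq// addr0.
move: A2 A3 A4 A5 A6 A7 A8 A9; move: (exprn_ge0 2 s0); clear; lra.
Qed.

(** Here [s = 0.411] separates the two regimes, and only the term of order [3] needs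
    the improved estimate. *)
Lemma mean_remainder2_le a s D n : mean_bounds a s -> (9 <= n)%N ->
  D <= \sum_(3 <= k < n) a k -> D <= 2 + a 2%N -> a 2%N <= s ^+ 2 ->
  D <= 315 / 10 * s ^+ 3.
Proof.
move=> ab n9 D_sum D2 a2; have [s0 a_small _] := ab.
have [sS|Ss] := leP s (411 / 1000); last first.
  apply: (le_trans D2).
  have h1 : (411 / 1000) ^+ 2 <= s ^+ 2.
    by apply: lerXn2r; rewrite ?nnegrE ?divr_ge0 ?ler0n// ltW.
  have h2 : 411 / 1000 * s ^+ 2 <= s ^+ 3.
    by rewrite [s ^+ 3]exprS ler_wpM2r ?exprn_ge0// ltW.
  move: h1 h2 a2; clear; lra.
have A3 : a 3%N <= 174 / 100 * s ^+ 3.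
  apply: (le_trans (@a_small 3 (1733 / 1000) isT _ _)); [by clear; lra|by clear; lra|].
  by rewrite exprMn mulrA ler_wpM2r ?exprn_ge0//=; clear; lra.
have x0 : 0 <= kappa R * s by rewrite mulr_ge0// ltW// kappa_gt0.
have xX : kappa R * s <= 7986 / 10000 by apply: (le_trans (kappaM_le s0 sS)); clear; lra.
have A4 : \sum_(4 <= k < n) a k <= 2908 / 100 * s ^+ 3.
  apply: (le_trans (@mean_tail_le _ _ 4 n _ ab isT xX _));
  first by clear; lra.
  have s3 := exprn_ge0 3 s0.
  have x3 : (kappa R * s) ^+ 3 <= 117 / 31 * (1943 / 1000) * s ^+ 3.
    rewrite exprMn ler_wpM2r// exprSr.
    exact: (ler_pM (exprn_ge0 2 (ltW (kappa_gt0 R))) (ltW (kappa_gt0 R))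
      (kappa_sqr_le R) (kappa_le R)).
  have X1 : 0 < 1 - 7986 / 10000 :> R by clear; lra.
  rewrite exprSr ler_pdivrMr ?X1//.
  have := ler_pM (exprn_ge0 3 x0) x0 x3 xX.
  move=> h; apply: (le_trans h); rewrite [leLHS]mulrAC [leRHS]mulrAC.
  by apply: ler_wpM2r => //; clear; lra.
apply: (le_trans D_sum); rewrite big_ltn ?(leq_trans _ n9)//.
move: A3 A4 (exprn_ge0 3 s0); clear; lra.
Qed.

(** Below [s = 0.409] the geometric tail suffices; the improved estimate of the term
    of order [3] is needed for the head. *)
Lemma mean_remainder3_le a s D n : mean_bounds a s -> (9 <= n)%N ->
  D <= \sum_(4 <= k < n) a k -> D <= 2 + a 2%N + a 3%N -> a 2%N <= s ^+ 2 ->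
  D <= 822 / 10 * s ^+ 4.
Proof.
move=> ab n9 D_sum D2 a2; have [s0 a_small _] := ab.
have [sS|Ss] := leP s (409 / 1000); last first.
  apply: (le_trans D2).
  have A3 : a 3%N <= 174 / 100 * s ^+ 3.
    apply: (le_trans (@a_small 3 (1733 / 1000) isT _ _)); [by clear; lra|by clear; lra|].
    by rewrite exprMn mulrA ler_wpM2r ?exprn_ge0//=; clear; lra.
  have h1 : (409 / 1000) ^+ 2 <= s ^+ 2.
    by apply: lerXn2r; rewrite ?nnegrE ?divr_ge0 ?ler0n// ltW.
  have h2 : 409 / 1000 * s ^+ 3 <= s ^+ 4.
    by rewrite [s ^+ 4]exprS ler_wpM2r ?exprn_ge0// ltW.
  have h3 : 409 / 1000 * s ^+ 2 <= s ^+ 3.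
    by rewrite [s ^+ 3]exprS ler_wpM2r ?exprn_ge0// ltW.
  move: A3 h1 h2 h3 a2; clear; lra.
have x0 : 0 <= kappa R * s by rewrite mulr_ge0// ltW// kappa_gt0.
have xX : kappa R * s <= 7947 / 10000 by apply: (le_trans (kappaM_le s0 sS)); clear; lra.
apply: (le_trans D_sum).
apply: (le_trans (@mean_tail_le _ _ 4 n _ ab isT xX _));
  first by clear; lra.
have k2 : 0 <= kappa R ^+ 2 by rewrite exprn_ge0// ltW// kappa_gt0.
have x4 : (kappa R * s) ^+ 4 <= 117 / 31 * (117 / 31) * s ^+ 4.
  rewrite exprMn ler_wpM2r ?exprn_ge0// (_ : 4%N = (2 + 2)%N)// exprD.
  exact: (ler_pM k2 k2 (kappa_sqr_le R) (kappa_sqr_le R)).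
have X1 : 0 < 1 - 7947 / 10000 :> R by clear; lra.
rewrite ler_pdivrMr ?X1//.
apply: (le_trans x4); rewrite [leRHS]mulrAC.
by apply: ler_wpM2r; [exact: exprn_ge0 | clear; lra].
Qed.

End small_orders.

(** * Elementary symmetric polynomials in a seminormed algebra *)

Section elem_sym.
Variable A : comNzRingType.

Definition elem_sym (n : nat) (f : 'I_n -> A) (k : nat) : A :=
  \sum_(J : {set 'I_n} | #|J| == k) \prod_(j in J) f j.

Lemma prodrD_elem_sym n (f : 'I_n -> A) g :
  \prod_j (f j + g) = \sum_(k < n.+1) elem_sym f k * g ^+ (n - k).
Proof.
rewrite bigA_distr (partition_big (fun J : {set 'I_n} => inord #|J| : 'I_n.+1) xpredT)//=.
apply: eq_bigr => k _; rewrite /elem_sym big_distrl/=.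
have card_lt (J : {set 'I_n}) : (#|J| < n.+1)%N.
  by rewrite ltnS -[leqRHS](card_ord n) max_card.
apply: eq_big => [J|J /eqP Jk].
  by rewrite -val_eqE/= inordK.
have cJ : #|J| = k by rewrite -Jk inordK.
rewrite (bigID (mem J))/=; congr (_ * _).
  by apply: eq_bigr => i ->.
under eq_bigr => i /negPf -> do [].
by rewrite prodr_const -cJ; congr (_ ^+ _); rewrite -[X in (X - _)%N](card_ord n)
  -(cardC (mem J)) addKn; apply: eq_card => i; rewrite !inE.
Qed.

Lemma coef_prod_elem_sym n (f : 'I_n -> A) k :
  (\prod_j (1 + (f j)%:P * 'X))`_k = elem_sym f k.
Proof.
under eq_bigr do rewrite addrC.
rewrite bigA_distr coef_sum /elem_sym [RHS]big_mkcond/=; apply: eq_bigr => J _.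
rewrite (bigID (mem J))/= (eq_bigr (fun j => (f j)%:P * 'X)); last by move=> i ->.
rewrite [X in _ * X]big1 ?mulr1; last by move=> i /negPf ->.
rewrite big_split/= prodr_const -rmorph_prod mul_polyC coefZ coefXn eq_sym.
by case: eqVneq; rewrite ?mulr1 ?mulr0.
Qed.

Lemma elem_sym0 n (f : 'I_n -> A) : elem_sym f 0 = 1.
Proof.
rewrite /elem_sym (big_pred1 (finset.set0 : {set _})) ?big_set0// => J.
by rewrite cards_eq0.
Qed.

Lemma elem_symMr n (f : 'I_n -> A) k g :
  elem_sym (fun j => f j * g) k = elem_sym f k * g ^+ k.
Proof.
rewrite /elem_sym mulr_suml; apply: eq_bigr => J /eqP cJ.
by rewrite big_split/= prodr_const cJ.
Qed.

Lemma elem_sym_gt n (f : 'I_n -> A) k : (n < k)%N -> elem_sym f k = 0.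
Proof.
move=> nk; rewrite /elem_sym big_pred0// => J; apply/negbTE.
by rewrite neq_ltn (leq_ltn_trans _ nk)// -[leqRHS](card_ord n) max_card.
Qed.

(** Congruence modulo [X^(K+1)], which lets polynomials stand for power series. *)
Definition eq_trunc (K : nat) (p q : {poly A}) :=
  forall k, (k <= K)%N -> p`_k = q`_k.

Lemma eq_truncM K p q p' q' :
  eq_trunc K p p' -> eq_trunc K q q' -> eq_trunc K (p * q) (p' * q').
Proof.
move=> pp' qq' k kK; rewrite !coefM; apply: eq_bigr => i _.
rewrite pp' ?qq'//; first exact: leq_trans (leq_subr _ _) kK.
by apply: leq_trans kK; rewrite -ltnS.
Qed.

Lemma eq_trunc_prod K (I : Type) (s : seq I) (p q : I -> {poly A}) :
  (forall i, eq_trunc K (p i) (q i)) ->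
  eq_trunc K (\prod_(i <- s) p i) (\prod_(i <- s) q i).
Proof.
move=> pq; elim/big_ind2 : _ => // *; exact: eq_truncM.
Qed.

End elem_sym.

Section kerstan.
Variables (R : realType) (A : comAlgType R).
Implicit Types (u v : A) (K k : nat).

Definition texp K u : {poly A} := \poly_(i < K.+1) ((i`!%:R^-1 : R) *: u ^+ i).

Lemma coef_texp K u k : (k <= K)%N -> (texp K u)`_k = (k`!%:R^-1 : R) *: u ^+ k.
Proof. by move=> kK; rewrite coef_poly ltnS kK. Qed.

Lemma texpD K u v : eq_trunc K (texp K u * texp K v) (texp K (u + v)).
Proof.
move=> k kK; rewrite coef_texp// coefM (addrC u) exprDn scaler_sumr.
apply: eq_bigr => -[i /=]; rewrite ltnS => ik _.
rewrite !coef_texp ?(leq_trans ik)//; last exact: leq_trans (leq_subr _ _) kK.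
rewrite -scalerAl -scalerAr scalerA (mulrC (u ^+ i)) -[_ *+ 'C(k, i)](@scaler_nat R) scalerA.
congr (_ *: _); rewrite -(bin_fact ik) !natrM.
have f0 m : m`!%:R != 0 :> R by rewrite pnatr_eq0 -lt0n fact_gt0.
have b0 : 'C(k, i)%:R != 0 :> R by rewrite pnatr_eq0 -lt0n bin_gt0.
by field; rewrite b0 !f0.
Qed.

Lemma texp0 K : eq_trunc K (texp K 0) 1.
Proof.
move=> k kK; rewrite coef_texp// expr0n coef1.
by case: k kK => [|k] _; rewrite ?scaler0//= fact0 invr1 scale1r.
Qed.

Lemma texp_sum K n (M : 'I_n -> A) :
  eq_trunc K (\prod_j texp K (M j)) (texp K (\sum_j M j)).
Proof.
elim/big_ind2 : _ => // [k kK|p u q v hp hq k kK].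
  by rewrite texp0.
by rewrite (eq_truncM hp hq)// texpD.
Qed.

Definition kfactor K u : {poly A} := (1 + u%:P * 'X) * texp K (- u).

(** The factorization [prod (1 + z M_j) = exp(z S) prod ((1 + z M_j) exp(- z M_j))],
    which separates the sum [S] of the [M_j] from the sum of their squares. *)
Lemma prod_kfactor K n (M : 'I_n -> A) :
  eq_trunc K (\prod_j (1 + (M j)%:P * 'X))
    (texp K (\sum_j M j) * \prod_j kfactor K (M j)).
Proof.
move=> k kK.
have -> : (texp K (\sum_j M j) * \prod_j kfactor K (M j))`_k =
    ((\prod_j texp K (M j)) * \prod_j kfactor K (M j))`_k.
  by apply: (@eq_truncM _ K) => // i iK; rewrite texp_sum.
rewrite -big_split/=.
apply: (@eq_trunc_prod _ K) => // i {kK}k kK.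
rewrite /kfactor mulrCA -[LHS](congr1 (fun p : {poly A} => p`_k) (mulr1 _)).
apply: (@eq_truncM _ K) => // {kK}k kK.
by rewrite texpD// subrr texp0.
Qed.

Lemma coef_kfactor K u k : (k <= K)%N ->
  (kfactor K u)`_k = ((-1) ^+ k.-1 * kcoef R k) *: u ^+ k.
Proof.
move=> kK; rewrite /kfactor mulrDl mul1r coefD -mulrA coefCM mulrC.
rewrite coefXM coef_texp//.
case: k kK => [|k] kK /=.
  by rewrite mul0r addr0 fact0 invr1 mulr1.
rewrite coef_texp ?(ltnW kK)// -(scaleN1r u) !exprZn !scalerA -scalerAl.
rewrite -exprSr -scalerDl factS natrM; congr (_ *: _).
have f0 m : m`!%:R != 0 :> R by rewrite pnatr_eq0 -lt0n fact_gt0.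
have k0 : k.+1%:R != 0 :> R by rewrite pnatr_eq0.
by rewrite exprS; field; rewrite f0 -natr1 /= in k0 *; rewrite addrC k0.
Qed.

Record alg_seminorm (N : A -> R) : Prop := AlgSeminorm {
  seminorm_ge0 : forall u, 0 <= N u;
  seminormD : forall u v, N (u + v) <= N u + N v;
  seminormM : forall u v, N (u * v) <= N u * N v;
  seminormZ : forall (c : R) u, N (c *: u) <= `|c| * N u;
  seminorm1 : N 1 <= 1 }.

Variables (N : A -> R) (semN : alg_seminorm N).
Let N_ge0 := seminorm_ge0 semN.
Let ND := seminormD semN.
Let NM := seminormM semN.
Let NZ := seminormZ semN.
Let N1 := seminorm1 semN.

Lemma seminorm0 : N 0 = 0.
Proof.
apply/eqP; rewrite eq_le N_ge0 andbT.
by have := NZ 0 0; rewrite scale0r normr0 mul0r.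
Qed.

Lemma seminorm_sum (I : Type) (s : seq I) (P : pred I) (F : I -> A) :
  N (\sum_(i <- s | P i) F i) <= \sum_(i <- s | P i) N (F i).
Proof.
elim/big_rec2 : _ => [|i y x _ h]; first by rewrite seminorm0.
by apply: le_trans (ND _ _) _; rewrite lerD2l.
Qed.

Lemma seminormX u k : N (u ^+ k) <= N u ^+ k.
Proof.
elim: k => [|k ih]; first by rewrite !expr0.
by rewrite !exprS (le_trans (NM _ _))// ler_wpM2l.
Qed.

Lemma seminorm_texp K u k : (k <= K)%N -> N (texp K u)`_k <= N u ^+ k / k`!%:R.
Proof.
move=> kK; rewrite coef_texp// (le_trans (NZ _ _))// mulrC ger0_norm ?invr_ge0//.
by rewrite ler_wpM2r ?invr_ge0// seminormX.
Qed.

Lemma seminorm_kfactor K u k : (k <= K)%N ->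
  N (kfactor K u)`_k <= kcoef R k * N u ^+ k.
Proof.
move=> kK; rewrite coef_kfactor// (le_trans (NZ _ _))// normrM normrX normrN1.
rewrite expr1n mul1r ger0_norm ?kcoef_ge0//.
by rewrite ler_wpM2l ?kcoef_ge0// seminormX.
Qed.

(** Truncation keeps this weighted norm submultiplicative, because a product of
    truncated sums contains all terms of the truncated product. *)
Definition tnorm K (r : R) (p : {poly A}) := \sum_(i < K.+1) N p`_i * r ^+ i.

Lemma tnorm_ge0 K r p : 0 <= r -> 0 <= tnorm K r p.
Proof. by move=> r0; rewrite sumr_ge0// => i _; rewrite mulr_ge0 ?exprn_ge0. Qed.

Lemma tnorm1 K r : tnorm K r 1 <= 1.
Proof.
rewrite /tnorm big_ord_recl/= coef1 expr0 mulr1 big1 ?addr0// => i _.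
by rewrite coef1 seminorm0 mul0r.
Qed.

Lemma tnormM K r p q : 0 <= r -> tnorm K r (p * q) <= tnorm K r p * tnorm K r q.
Proof.
move=> r0; rewrite /tnorm.
apply: (@le_trans _ _ (\sum_(k < K.+1) \sum_(i < k.+1)
    (N p`_i * r ^+ i) * (N q`_(k - i) * r ^+ (k - i)))).
  apply: ler_sum => k _; rewrite coefM.
  apply: le_trans (ler_wpM2r _ (seminorm_sum _ _ _)) _; first by rewrite exprn_ge0.
  rewrite mulr_suml; apply: ler_sum => i _.
  rewrite mulrACA -exprD subnKC -1?ltnS//.
  by rewrite ler_wpM2r ?exprn_ge0.
set P := \poly_(i < K.+1) (N p`_i * r ^+ i).
set Q := \poly_(i < K.+1) (N q`_i * r ^+ i).
have -> : \sum_(i < K.+1) N p`_i * r ^+ i = P.[1].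
  by rewrite horner_poly; apply: eq_bigr => i _; rewrite expr1n mulr1.
have -> : \sum_(i < K.+1) N q`_i * r ^+ i = Q.[1].
  by rewrite horner_poly; apply: eq_bigr => i _; rewrite expr1n mulr1.
have Pge i : 0 <= P`_i by rewrite coef_poly; case: ifP => // _; rewrite mulr_ge0 ?exprn_ge0.
have Qge i : 0 <= Q`_i by rewrite coef_poly; case: ifP => // _; rewrite mulr_ge0 ?exprn_ge0.
rewrite -hornerM (horner_coef_wide _ (leq_maxr K.+1 _)).
rewrite -(subnKC (leq_maxl K.+1 (size (P * Q)))) big_split_ord/=.
apply: (@le_trans _ _ (\sum_(i < K.+1) (P * Q)`_i)).
  rewrite le_eqVlt; apply/orP; left; apply/eqP.
  apply: eq_bigr => k _; rewrite coefM; apply: eq_bigr => i _.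
  rewrite !coef_poly (leq_trans (ltn_ord i))// ?ltn_ord//.
  by rewrite (leq_ltn_trans (leq_subr _ _)).
under [X in _ <= X + _]eq_bigr do rewrite expr1n mulr1.
rewrite lerDl sumr_ge0// => i _; rewrite expr1n mulr1 coefM sumr_ge0// => j _.
by rewrite mulr_ge0.
Qed.

Lemma tnorm_prod K r (I : Type) (s : seq I) (p : I -> {poly A}) : 0 <= r ->
  tnorm K r (\prod_(i <- s) p i) <= \prod_(i <- s) tnorm K r (p i).
Proof.
move=> r0; elim/big_rec2 : _ => [|i y x _ h]; first exact: tnorm1.
by apply: le_trans (tnormM _ _ _ r0) _; rewrite ler_wpM2l// tnorm_ge0.
Qed.

Lemma tnorm_kfactor K r u : 0 <= r -> tnorm K r (kfactor K u) <= phi (r * N u).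
Proof.
move=> r0; apply: le_trans (series_kcoef_le_phi K.+1 (mulr_ge0 r0 (N_ge0 u))).
apply: ler_sum => i _; rewrite exprMn (mulrC (r ^+ i)) mulrA.
by rewrite ler_wpM2r ?exprn_ge0// seminorm_kfactor// -ltnS.
Qed.

(** The [k]-th coefficient of [exp(z S) Q(z)] is a sum of products of one coefficient
    of each factor.  All the coefficients of [exp(z S)] satisfy the same bound
    [exp((r N S)^2 / 4)], and those of [Q] are summed by [tnorm]. *)
Lemma elem_sym_le n (M : 'I_n -> A) k (c r : R) : 0 < r ->
  (forall x : R, 0 <= x -> phi x <= expR (c * x ^+ 2)) ->
  r ^+ k * N (elem_sym M k) <=
    expR (r ^+ 2 * (N (\sum_j M j) ^+ 2 / 4 + c * \sum_j N (M j) ^+ 2)).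
Proof.
move=> r0 phic; have r_ge0 := ltW r0.
set S := N (\sum_j M j); set Q := \prod_j kfactor k (M j).
have leQ : tnorm k r Q <= expR (r ^+ 2 * (c * \sum_j N (M j) ^+ 2)).
  apply: le_trans (tnorm_prod _ _ _ r_ge0) _.
  rewrite !mulr_sumr expR_sum; apply: ler_prod => j _.
  rewrite tnorm_ge0//= (le_trans (tnorm_kfactor _ _ r_ge0))//.
  apply: le_trans (phic _ (mulr_ge0 r_ge0 (N_ge0 _))) _.
  by rewrite exprMn mulrCA.
rewrite -coef_prod_elem_sym (prod_kfactor _ (leqnn k)) coefM.
rewrite mulrDr expRD [r ^+ 2 * (S ^+ 2 / 4)]mulrA -exprMn.
apply: le_trans (ler_wpM2l _ (seminorm_sum _ _ _)) _; first by rewrite exprn_ge0.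
apply: (@le_trans _ _ (expR ((r * S) ^+ 2 / 4) * tnorm k r Q)); last first.
  by rewrite ler_wpM2l// expR_ge0.
rewrite /tnorm mulr_sumr mulr_sumr (reindex_inj rev_ord_inj)/=.
apply: ler_sum => i _; rewrite subSS subKn -1?ltnS//.
apply: le_trans (ler_wpM2l _ (NM _ _)) _; first by rewrite exprn_ge0.
have -> : r ^+ k = r ^+ (k - i) * r ^+ i by rewrite -exprD subnK// -ltnS.
rewrite mulrACA [r ^+ i * _]mulrC.
rewrite ler_wpM2r ?mulr_ge0 ?exprn_ge0//.
apply: le_trans (pow_fact_le_expR (k - i) (mulr_ge0 r_ge0 (N_ge0 _))).
rewrite exprMn -mulrA ler_wpM2l ?exprn_ge0//.
exact: seminorm_texp (leq_subr _ _).
Qed.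

(** Induction on the number of factors: [exp(a z^2 + b z^3)] turns sums of the
    exponents into products, and its coefficients are nonnegative. *)
Lemma coef_prod_kfactor_le (s : seq A) k : (k <= 8)%N ->
  N (\prod_(u <- s) kfactor 8 u)`_k <=
  (exp23_coef (\sum_(u <- s) N u ^+ 2 / 2) (\sum_(u <- s) N u ^+ 3 / 3))`_k.
Proof.
have s0 m (t : seq A) c : 0 <= c -> 0 <= \sum_(u <- t) N u ^+ m / c.
  by move=> c0; rewrite sumr_ge0// => i _; rewrite divr_ge0 ?exprn_ge0.
elim: s k => [|u s ih] k k8.
  rewrite !big_nil coef1; case: k k8 => [|k] k8; first by rewrite N1.
  by rewrite seminorm0 exp23_coef_ge0.
rewrite !big_cons -exp23_coefD// coefM (le_trans (seminorm_sum _ _ _))//.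
apply: ler_sum => -[i /=]; rewrite ltnS => ik _.
apply: le_trans (NM _ _) _; apply: ler_pM => //.
  apply: le_trans (seminorm_kfactor _ (leq_trans ik k8)) _.
  exact: kcoef_le_exp23 (leq_trans ik k8).
exact/ih/(leq_trans (leq_subr _ _)).
Qed.

(** Since the [M_j] add up to zero, the exponential factor is trivial.  The sum of
    the cubes is at most [s^3], because each [N (M j)] is at most [s]. *)
Lemma elem_sym_sum0_le n (M : 'I_n -> A) k (s : R) : (k <= 8)%N ->
  \sum_j M j = 0 -> 0 <= s -> \sum_j N (M j) ^+ 2 <= s ^+ 2 ->
  N (elem_sym M k) <= (exp23_coef (2^-1) (3^-1))`_k * s ^+ k.
Proof.
move=> k8 M0 s0 Ms.
have Mj j : N (M j) <= s.
  rewrite -(@ler_pXn2r _ 2) ?nnegrE//; apply: le_trans Ms.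
  by rewrite (bigD1 j)//= lerDl sumr_ge0// => i _; rewrite exprn_ge0.
rewrite -coef_prod_elem_sym (prod_kfactor _ k8) M0.
rewrite (eq_truncM (@texp0 8) (fun _ _ => erefl _) k8) mul1r.
have -> : \prod_j kfactor 8 (M j) = \prod_(u <- map M (index_enum _)) kfactor 8 u.
  by rewrite big_map.
apply: le_trans (coef_prod_kfactor_le _ k8) _; rewrite !big_map -!mulr_suml.
have a0 : 0 <= \sum_j N (M j) ^+ 2 by rewrite sumr_ge0// => i _; rewrite exprn_ge0.
have b0 : 0 <= \sum_j N (M j) ^+ 3 by rewrite sumr_ge0// => i _; rewrite exprn_ge0.
have bs : \sum_j N (M j) ^+ 3 <= s ^+ 3.
  apply: (@le_trans _ _ (s * \sum_j N (M j) ^+ 2)).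
    by rewrite mulr_sumr ler_sum// => j _; rewrite exprS ler_wpM2r ?exprn_ge0.
  by rewrite exprS ler_wpM2l.
move: (\sum_j N (M j) ^+ 2) (\sum_j N (M j) ^+ 3) a0 b0 Ms bs => a b a0 b0 a_le b_le.
rewrite -exp23_coef_homog exp23_coef_le ?divr_ge0// mulrC ler_wpM2l ?invr_ge0//.
Qed.
End kerstan.

Section kerstan_bound.
Variables (R : realType) (A : comAlgType R) (N : A -> R).
Hypothesis semN : alg_seminorm N.

(** [elem_sym_le] with radius [r = e^(1/2) / x]: its exponent is then at most [k / 2]
    as soon as [x^2 >= 2 e c1 eta]. *)
Lemma kerstan_bound n (M : 'I_n -> A) k (eta : R) : (0 < k)%N ->
  k%:R^-1 * (N (\sum_j M j) ^+ 2 / (4 * c1 R) + \sum_j N (M j) ^+ 2) <= eta ->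
  N (elem_sym M k) <= (kappa R * Num.sqrt eta) ^+ k.
Proof.
move=> k0 h; have c0 := c1_gt0 R; have kr0 : 0 < k%:R :> R by rewrite ltr0n.
set S := N _ in h; set nu2 := \sum_j _ in h.
have nu2_ge0 : 0 <= nu2 by rewrite sumr_ge0// => j _; rewrite exprn_ge0// seminorm_ge0.
have S2 : 0 <= S ^+ 2 / (4 * c1 R).
  by rewrite divr_ge0 ?exprn_ge0 ?(seminorm_ge0 semN)// mulr_ge0 ?ltW.
have eta0 : 0 <= eta by apply: le_trans h; rewrite mulr_ge0 ?invr_ge0 ?ler0n ?addr_ge0.
have h' : S ^+ 2 / 4 + c1 R * nu2 <= c1 R * k%:R * eta.
  rewrite -mulrA; move: h; rewrite ler_pdivrMl// => h.
  have := ler_wpM2l (ltW c0) h; rewrite mulrDr.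
  by have -> : c1 R * (S ^+ 2 / (4 * c1 R)) = S ^+ 2 / 4 by field; rewrite gt_eqF.
have key x : 0 < x -> kappa R ^+ 2 * eta <= x ^+ 2 -> N (elem_sym M k) <= x ^+ k.
  move=> x0 xeta.
  have r0 : 0 < expR (2^-1) / x by rewrite divr_gt0 ?expR_gt0.
  have := elem_sym_le semN M k r0 (@phi_le_c1 R).
  have r2 : (expR (2^-1) / x) ^+ 2 = expR 1 / x ^+ 2.
    by rewrite expr_div_n -expRM_natr mulVf.
  rewrite r2 -/S -/nu2 exprMn -expRM_natr exprVn mulrAC => le1.
  have le2 : expR (expR 1 / x ^+ 2 * (S ^+ 2 / 4 + c1 R * nu2)) <= expR (2^-1 * k%:R).
    rewrite ler_expR mulrAC ler_pdivrMr ?exprn_gt0//.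
    apply: (le_trans (ler_wpM2l (expR_ge0 1) h')).
    have := ler_wpM2l (ltW kr0) xeta; rewrite kappa_sqr => le3.
    have -> : expR 1 * (c1 R * k%:R * eta) =
      2^-1 * (k%:R * (2 * expR 1 * c1 R * eta)) by field.
    by rewrite -[leRHS]mulrA ler_wpM2l.
  have := le_trans le1 le2; rewrite ler_pdivrMr ?exprn_gt0//.
  by rewrite ler_pM2l ?expR_gt0.
(* If eta = 0 there is no optimal radius, and x tends to 0. *)
have [e0|e0] := eqVneq eta 0.
  have N0 : N (elem_sym M k) <= 0.
    apply/ler_addgt0Pr => e e_gt0; rewrite add0r.
    pose x := Num.min e 1.
    have x0 : 0 < x by rewrite lt_min e_gt0 ltr01.
    have x1 : x <= 1 by rewrite ge_min lexx orbT.
    apply: (@le_trans _ _ (x ^+ k)); first by apply: key => //; rewrite e0 mulr0 exprn_ge0 ?ltW.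
    apply: (@le_trans _ _ x); last by rewrite ge_min lexx.
    by rewrite -[leRHS]expr1; apply: ler_wiXn2l => //; rewrite ?ltW.
  by apply: (le_trans N0); rewrite exprn_ge0// mulr_ge0 ?sqrtr_ge0// ltW// kappa_gt0.
apply: key; first by rewrite mulr_gt0 ?kappa_gt0// sqrtr_gt0 lt_neqAle eq_sym e0.
by rewrite exprMn [Num.sqrt eta ^+ 2]sqr_sqrtr.
Qed.

End kerstan_bound.

Section expansion.
Variables (R : realType) (A : comAlgType R) (N : A -> R).
Hypothesis semN : alg_seminorm N.
Variables (n : nat) (f : 'I_n -> A) (g : A).
Hypotheses (f1 : forall j, N (f j) <= 1) (g1 : N g <= 1).

Let dfg j := f j - g.

Definition smooth k j := dfg j * g ^+ ((n - k) %/ k).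

Definition term_norm k := N (elem_sym dfg k * g ^+ (n - k)).

Definition remainder l := N (\prod_j f j - \sum_(k < l.+1) elem_sym dfg k * g ^+ (n - k)).

Let NgX k : N (g ^+ k) <= 1.
Proof.
apply: (le_trans (seminormX semN _ _)).
by apply: exprn_ile1 => //; rewrite (seminorm_ge0 semN).
Qed.

Lemma term_norm_ge0 k : 0 <= term_norm k.
Proof. exact: seminorm_ge0. Qed.

Lemma term_norm_gt k : (n < k)%N -> term_norm k = 0.
Proof. by move=> nk; rewrite /term_norm elem_sym_gt// mul0r (seminorm0 semN). Qed.

Lemma term_norm0 : term_norm 0 <= 1.
Proof. by rewrite /term_norm elem_sym0 mul1r. Qed.

(** Of the [n - k] factors [g], [k * ((n - k) %/ k)] are distributed evenly over the
    [k] factors of each product; the others have norm at most [1]. *)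
Lemma term_norm_smooth k : (0 < k)%N -> term_norm k <= N (elem_sym (smooth k) k).
Proof.
move=> k0; have [kn|nk] := leqP k n; last by rewrite term_norm_gt// seminorm_ge0.
rewrite /term_norm /smooth elem_symMr {1}(divn_eq (n - k) k) exprD exprM mulrA.
apply: (le_trans (seminormM semN _ _)).
by rewrite ler_piMr// (seminorm_ge0 semN).
Qed.

Lemma prod_expansion m : (n < m)%N ->
  \prod_j f j = \sum_(0 <= k < m) elem_sym dfg k * g ^+ (n - k).
Proof.
move=> nm; transitivity (\prod_j (dfg j + g)).
  by apply: eq_bigr => j _; rewrite /dfg subrK.
rewrite prodrD_elem_sym (big_cat_nat (n := n.+1))//= big_mkord [X in _ = _ + X]big1_seq ?addr0//.
by move=> k; rewrite mem_index_iota => /andP[_ /andP[nk _]]; rewrite elem_sym_gt// mul0r.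
Qed.

Lemma remainder_le_tail l m : (l <= n)%N -> (n < m)%N ->
  remainder l <= \sum_(l.+1 <= k < m) term_norm k.
Proof.
move=> ln nm; rewrite /remainder (prod_expansion nm).
rewrite (big_cat_nat (n := l.+1))//=; last by rewrite (leq_ltn_trans ln).
rewrite big_mkord [X in N (X - _)]addrC addrK; exact: seminorm_sum.
Qed.

Lemma remainder_le_head l : remainder l <= 1 + \sum_(0 <= k < l.+1) term_norm k.
Proof.
apply: (le_trans (seminormD semN _ _)); apply: lerD.
  elim/big_rec : _ => [|j y _ y1]; first exact: seminorm1.
  apply: (le_trans (seminormM semN _ _)).
  by apply: mulr_ile1 => //; rewrite (seminorm_ge0 semN).
rewrite -scaleN1r; apply: (le_trans (seminormZ semN _ _)).
rewrite normrN1 mul1r big_mkord; exact: seminorm_sum.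
Qed.

Section bounds.
Variable eta : R.

Lemma term_norm_le k : (0 < k)%N ->
  k%:R^-1 * (N (\sum_j smooth k j) ^+ 2 / (4 * c1 R) + \sum_j N (smooth k j) ^+ 2)
    <= eta ->
  term_norm k <= (kappa R * Num.sqrt eta) ^+ k.
Proof.
by move=> k0 h; apply: (le_trans (term_norm_smooth k0)); exact: kerstan_bound.
Qed.

Hypothesis mean : \sum_j dfg j = 0.

Lemma sum_smooth0 k : \sum_j smooth k j = 0.
Proof. by rewrite /smooth -mulr_suml mean mul0r. Qed.

Lemma term_norm1 : term_norm 1 = 0.
Proof.
apply/eqP; rewrite eq_le term_norm_ge0 andbT.
apply: (le_trans (@term_norm_smooth 1 isT)).
set t := \sum_j N (smooth 1 j) ^+ 2.
have t0 : 0 <= t by rewrite sumr_ge0// => j _; rewrite exprn_ge0// seminorm_ge0.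
have := elem_sym_sum0_le semN (k := 1) (s := Num.sqrt t) isT (sum_smooth0 1).
by rewrite sqr_sqrtr//= mul0r; apply => //; exact: sqrtr_ge0.
Qed.

Lemma term_norm_small k r : (2 <= k <= 8)%N -> 0 <= r -> k%:R <= r ^+ 2 -> 0 <= eta ->
  k%:R^-1 * \sum_j N (smooth k j) ^+ 2 <= eta ->
  term_norm k <= (exp23_coef (2^-1) (3^-1))`_k * (r * Num.sqrt eta) ^+ k.
Proof.
move=> /andP[k2 k8] r0 kr eta0 h; apply: (le_trans (term_norm_smooth (ltnW k2))).
apply: elem_sym_sum0_le => //; first exact: sum_smooth0.
  by rewrite mulr_ge0 ?sqrtr_ge0.
rewrite exprMn sqr_sqrtr//; move: h; rewrite ler_pdivrMl ?ltr0n ?(ltnW k2)// => h.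
by apply: (le_trans h); rewrite ler_wpM2r.
Qed.

End bounds.
End expansion.

(** * Convolution of finite measures *)

Section mconv.
Context d (T : measurableAbGroupType d) (R : realType).
Implicit Types (p q r s : {finite_measure set T -> \bar R}) (A : set T).
Local Open Scope ereal_scope.

Definition addm (z : T * T) : T := (z.2 + z.1)%R.

(** The law of the sum of independent variables with laws [p] and [r]. *)
Definition mconv p r : set T -> \bar R := pushforward (r \x p) addm.

Let mconv_measure p r : {measure set T -> \bar R} :=
  measure_function_pushforward__canonical__measure_function_Measure (r \x p) (@measurable_add d T).

Lemma mconvE p r A : mconv p r A = \int[r]_x p (translate A x).
Proof.
rewrite /mconv /pushforward /product_measure1; apply: eq_integral => x _ /=.
by rewrite shift_xsection.
Qed.

HB.instance Definition _ p r := isMeasure.Build _ _ _ (mconv p r)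
  (measure0 (mconv_measure p r)) (measure_ge0 (mconv_measure p r))
  (@measure_semi_sigma_additive _ _ _ (mconv_measure p r)).

Lemma mconvT p r : mconv p r [set: T] = p [set: T] * r [set: T].
Proof.
rewrite mconvE (eq_integral (cst (p [set: T]))) ?integral_cst//.
Qed.

Let mconv_fin p r : fin_num_fun (mconv p r).
Proof.
move=> A mA; rewrite ge0_fin_numE ?measure_ge0//.
apply: (@le_lt_trans _ _ (mconv p r [set: T])).
  by apply: le_measure; rewrite ?inE.
by rewrite mconvT ltey_eq fin_numM ?fin_num_measure.
Qed.

HB.instance Definition _ p r := @Measure_isFinite.Build _ _ _ (mconv p r) (@mconv_fin p r).

Lemma measurable_fun_translate p A : measurable A ->
  measurable_fun [set: T] (fun x => p (translate A x)).
Proof. exact: (measurable_fun_shift (charge_of_finite_measure p)). Qed.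

(** Tonelli's theorem: both iterated integrals define the product measure. *)
Lemma mconvC p r A : measurable A -> mconv p r A = mconv r p A.
Proof.
move=> mA; have mB := measurable_add_preimage mA.
rewrite {1}/mconv /pushforward.
rewrite (@product_measure_unique _ _ _ _ _ _ _ (r \x^ p)); last exact: mB.
  rewrite /product_measure2 mconvE; apply: eq_integral => x _ /=.
  by congr (r _); apply/seteqP; split=> y; rewrite /ysection/translate/addm/= inE/= addrC.
by move=> B C mBB mC; exact: product_measure2E.
Qed.

Lemma integral_mconv p r (f : T -> \bar R) : measurable_fun [set: T] f ->
  (forall x, 0 <= f x) ->
  \int[mconv p r]_x f x = \int[r]_x \int[p]_y f (y + x)%R.
Proof.
move=> mf f0.
rewrite [LHS](@ge0_integral_pushforward _ _ _ _ _ _ (@measurable_add d T) (r \x p) setT)//=.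
rewrite preimage_setT (@fubini_tonelli1 _ _ _ _ _ r p)//=.
exact: measurableT_comp mf (@measurable_add d T).
Qed.

Lemma mconvA p r s A : measurable A -> mconv (mconv p r) s A = mconv p (mconv r s) A.
Proof.
move=> mA; rewrite mconvE [RHS]mconvE integral_mconv//; last exact: measurable_fun_translate.
apply: eq_integral => z _; rewrite [LHS]mconvE; apply: eq_integral => x _.
by congr (p _); apply/seteqP; split=> y; rewrite /translate/= addrA.
Qed.

Lemma eq_mconvl p q r A : measurable A -> (forall B, measurable B -> p B = q B) ->
  mconv p r A = mconv q r A.
Proof.
move=> mA pq; rewrite !mconvE; apply: eq_integral => x _.
by rewrite pq//; exact: measurable_shift.
Qed.

(** A copy of [measure_add] that carries a structure of finite measure. *)
Definition madd p q : set T -> \bar R := measure_add p q.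

HB.instance Definition _ p q := Measure.on (madd p q).

Let madd_fin p q : fin_num_fun (madd p q).
Proof. by move=> A mA; rewrite /madd measure_addE fin_numD !fin_num_measure. Qed.

HB.instance Definition _ p q := @Measure_isFinite.Build _ _ _ (madd p q) (@madd_fin p q).

Lemma maddE p q A : madd p q A = p A + q A.
Proof. exact: measure_addE. Qed.

Lemma mconvDl p q r A : measurable A -> mconv (madd p q) r A = mconv p r A + mconv q r A.
Proof.
move=> mA; rewrite !mconvE -ge0_integralD//; try exact: measurable_fun_translate.
by apply: eq_integral => x _; exact: maddE.
Qed.

End mconv.

(** * Convolution and total variation of signed measures *)

Section charge_norm.
Context d (T : measurableType d) (R : realType).
Implicit Types (V W : charge T R) (A B : set T).
Implicit Types (p q r s : {finite_measure set T -> \bar R}).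

Lemma fine_finite_measure_le p A B : measurable A -> measurable B -> A `<=` B ->
  fine (p A) <= fine (p B).
Proof.
by move=> mA mB AB; rewrite fine_le ?fin_num_measure// le_measure ?inE.
Qed.

Lemma fine_charge_posneg V A : measurable A ->
  fine (V A) = fine (charge_pos V A) - fine (charge_neg V A).
Proof.
move=> mA; rewrite (charge_posnegE V mA) fineB ?fin_num_measure//.
Qed.

Lemma charge_norm_posneg V :
  charge_norm V = fine (charge_pos V [set: T]) + fine (charge_neg V [set: T]).
Proof. by rewrite /charge_norm /charge_variation /= fineD ?fin_num_measure. Qed.

Lemma charge_norm_ge0 V : 0 <= charge_norm V.
Proof. by rewrite charge_norm_posneg addr_ge0// fine_ge0. Qed.

(** Together with [charge_norm_disjoint], this says that the total variation is the
    maximum of [|V A| + |V B|] over disjoint measurable sets; most properties of the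
    norm follow from these two facts alone. *)
Lemma charge_norm_hahn V : exists P N, [/\ measurable P, measurable N,
  P `&` N = set0 & charge_norm V = fine (V P) - fine (V N)].
Proof.
have [P [N PN]] := Hahn_decomposition V; exists P, N.
have [[mP _] [mN _] _ PN0] := PN; split => //.
rewrite (charge_normE PN) /charge_variation /= jordan_posE jordan_negE.
rewrite cjordan_posE cjordan_negE /crestr0 !mem_set// /crestr !setTI.
by rewrite fineD ?fin_numN ?fin_num_measure// fineN.
Qed.

Lemma charge_norm_disjoint V A B : measurable A -> measurable B ->
  A `&` B = set0 -> `|fine (V A)| + `|fine (V B)| <= charge_norm V.
Proof.
move=> mA mB AB0.
have h p : fine (p A) + fine (p B) <= fine (p [set: T]).
  rewrite -fineD ?fin_num_measure// -measureU//.
  by apply: fine_finite_measure_le => //; exact: measurableU.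
have g p C : 0 <= fine (p C) by rewrite fine_ge0.
rewrite (fine_charge_posneg V mA) (fine_charge_posneg V mB) charge_norm_posneg.
have := h (charge_pos V); have := h (charge_neg V).
have := ler_normB (fine (charge_pos V A)) (fine (charge_neg V A)).
have := ler_normB (fine (charge_pos V B)) (fine (charge_neg V B)).
rewrite !(ger0_norm (g _ _)).
move: (`|_|) (`|_|) => a b; lra.
Qed.

(** A signed measure is handled through any representation as a difference of two
    finite measures, not only its Jordan decomposition, since representations are
    stable under convolution. *)
Definition charge_diff V p q := forall A, measurable A ->
  fine (V A) = fine (p A) - fine (q A).

Lemma charge_norm_diff_le V p q : charge_diff V p q ->
  charge_norm V <= fine (p [set: T]) + fine (q [set: T]).
Proof.
move=> Vpq; have [P [N [mP mN PN ->]]] := charge_norm_hahn V.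
rewrite !Vpq//.
have := fine_finite_measure_le p mP measurableT (@subsetT _ _).
have := fine_finite_measure_le q mN measurableT (@subsetT _ _).
have : 0 <= fine (p N) by rewrite fine_ge0.
have : 0 <= fine (q P) by rewrite fine_ge0.
lra.
Qed.

End charge_norm.

Section convolution.
Context d (T : measurableAbGroupType d) (R : realType).
Implicit Types (V W U : charge T R) (A : set T).
Implicit Types (p q r s : {finite_measure set T -> \bar R}).

Local Notation fmconv p r := (mconv p r : {finite_measure set T -> \bar R}).
Local Notation fmadd p r := (madd p r : {finite_measure set T -> \bar R}).

Definition convr p r A : R := fine (fmconv p r A).

Lemma fine_mconv p r A : fine (fmconv p r A) = convr p r A.
Proof. by []. Qed.

Lemma fine_madd p q A : measurable A -> fine (fmadd p q A) = fine (p A) + fine (q A).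
Proof. by move=> mA; rewrite -fineD ?fin_num_measure//; congr fine; exact: maddE. Qed.

Lemma convrC p r A : measurable A -> convr p r A = convr r p A.
Proof. by move=> mA; rewrite /convr; congr fine; exact: mconvC. Qed.

Lemma convrA p r s A : measurable A -> convr (mconv p r) s A = convr p (mconv r s) A.
Proof. by move=> mA; rewrite /convr; congr fine; exact: mconvA. Qed.

Lemma convrDl p q r A : measurable A -> convr (madd p q) r A = convr p r A + convr q r A.
Proof. move=> mA; rewrite /convr -fineD ?fin_num_measure//; congr fine; exact: mconvDl. Qed.

Lemma convrDr p q r A : measurable A -> convr r (madd p q) A = convr r p A + convr r q A.
Proof. by move=> mA; rewrite convrC// convrDl// !(convrC r). Qed.

Lemma eq_convrr p q r A : measurable A -> (forall B, measurable B -> p B = q B) ->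
  convr r p A = convr r q A.
Proof. by move=> mA pq; rewrite !(convrC r)// /convr; congr fine; exact: eq_mconvl. Qed.

Lemma integrable_translate p r A : measurable A ->
  r.-integrable [set: T] (fun x => p (translate A x)).
Proof.
move=> mA; apply/integrableP; split; first exact: measurable_fun_translate.
under eq_integral do rewrite gee0_abs//.
by rewrite -mconvE ltey_eq fin_num_measure.
Qed.

Lemma charge_translateE V A x : measurable A -> V (translate A x) =
  (charge_pos V (translate A x) - charge_neg V (translate A x))%E.
Proof. by move=> mA; apply: charge_posnegE; exact: measurable_shift. Qed.

Lemma integrable_charge_translate V r A : measurable A ->
  r.-integrable [set: T] (fun x => V (translate A x)).
Proof.
move=> mA; under eq_fun do rewrite charge_translateE//.
by apply: integrableB => //; exact: integrable_translate.
Qed.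

Lemma integral_charge_translate V p q r A : charge_diff V p q -> measurable A ->
  fine (\int[r]_x V (translate A x)) = convr p r A - convr q r A.
Proof.
move=> Vpq mA.
rewrite (eq_integral (fun x => p (translate A x) - q (translate A x))%E); last first.
  move=> x _; have mAx := measurable_shift x mA.
  rewrite -(fineK (fin_num_measure V _ mAx)) Vpq//.
  by rewrite EFinB !fineK ?fin_num_measure.
rewrite integralB//; try exact: integrable_translate.
by rewrite -!mconvE fineB ?fin_num_measure.
Qed.

Lemma fine_chmul V W A : measurable A -> fine (chmul V W A) =
  fine (\int[charge_pos W]_x V (translate A x)) -
  fine (\int[charge_neg W]_x V (translate A x)).
Proof.
move=> mA; rewrite /chmul/= /convolution /charge_integral fineB//;
  by apply: integrable_fin_num => //; exact: integrable_charge_translate.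
Qed.

(** [(p - q) (r - s) = (p r + q s) - (p s + q r)].  The convolution is defined by the
    Jordan decomposition of [W]; replacing it by [r - s] uses that the sum of the
    positive part and [s] agrees with the sum of the negative part and [r]. *)
Lemma chmul_diff V W p q r s : charge_diff V p q -> charge_diff W r s ->
  charge_diff (chmul V W) (madd (mconv p r) (mconv q s)) (madd (mconv p s) (mconv q r)).
Proof.
move=> Vpq Wrs A mA; rewrite fine_chmul// !(integral_charge_translate _ Vpq)//.
rewrite !fine_madd// !fine_mconv.
have h t : convr t (charge_pos W) A + convr t s A = convr t (charge_neg W) A + convr t r A.
  rewrite -!convrDr//; apply: eq_convrr => // B mB; rewrite [LHS]maddE [RHS]maddE.
  have := Wrs _ mB; rewrite (fine_charge_posneg W mB) => e.
  have fin p' q' : (p' B + q' B)%E \is a fin_num by rewrite fin_numD !fin_num_measure.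
  rewrite -(fineK (fin (charge_pos W) s)) -(fineK (fin (charge_neg W) r)).
  congr (_%:E); rewrite !fineD ?fin_num_measure//; lra.
have := h p; have := h q; lra.
Qed.

Lemma chmulC V W A : measurable A -> fine (chmul V W A) = fine (chmul W V A).
Proof.
move=> mA.
have rV := fine_charge_posneg V; have rW := fine_charge_posneg W.
rewrite (chmul_diff rV rW mA) (chmul_diff rW rV mA).
rewrite !fine_madd// !fine_mconv.
rewrite !(convrC (charge_pos W))// !(convrC (charge_neg W))//; lra.
Qed.

Lemma chmulA V W U A : measurable A ->
  fine (chmul (chmul V W) U A) = fine (chmul V (chmul W U) A).
Proof.
move=> mA.
have rV := fine_charge_posneg V; have rW := fine_charge_posneg W.
have rU := fine_charge_posneg U.
rewrite (chmul_diff (chmul_diff rV rW) rU mA) (chmul_diff rV (chmul_diff rW rU) mA).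
rewrite !fine_madd// !fine_mconv.
rewrite !convrDl// !convrDr// !convrA//; lra.
Qed.

Lemma eq_chmul V V' W W' A : measurable A ->
  (forall B, measurable B -> fine (V B) = fine (V' B)) ->
  (forall B, measurable B -> fine (W B) = fine (W' B)) ->
  fine (chmul V W A) = fine (chmul V' W' A).
Proof.
move=> mA VV' WW'.
have rV := fine_charge_posneg V; have rW := fine_charge_posneg W.
have rV' : charge_diff V' (charge_pos V) (charge_neg V) by move=> B mB; rewrite -VV'// rV.
have rW' : charge_diff W' (charge_pos W) (charge_neg W) by move=> B mB; rewrite -WW'// rW.
by rewrite (chmul_diff rV rW mA) (chmul_diff rV' rW' mA).
Qed.

Lemma chmulDl V V' W A : measurable A ->
  fine (chmul (chadd V V') W A) = fine (chmul V W A) + fine (chmul V' W A).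
Proof.
move=> mA; rewrite !fine_chmul//.
have h r : fine (\int[r]_x chadd V V' (translate A x)) =
    fine (\int[r]_x V (translate A x)) + fine (\int[r]_x V' (translate A x)).
  rewrite /chadd /cadd/= integralD//; try exact: integrable_charge_translate.
  by rewrite fineD//; apply: integrable_fin_num => //; exact: integrable_charge_translate.
rewrite !h; lra.
Qed.

Lemma chmulZl c V W A : measurable A ->
  fine (chmul (cscale c V : charge T R) W A) = c * fine (chmul V W A).
Proof.
move=> mA; rewrite !fine_chmul//.
have h r : fine (\int[r]_x cscale c V (translate A x)) =
    c * fine (\int[r]_x V (translate A x)).
  rewrite /cscale/= integralZl//; last exact: integrable_charge_translate.
  by rewrite fineM//; apply: integrable_fin_num => //; exact: integrable_charge_translate.
rewrite !h; lra.
Qed.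

Lemma mconv_dirac p A : measurable A ->
  mconv p (\d_(0 : T) : {finite_measure set T -> \bar R}) A = p A.
Proof.
move=> mA; rewrite mconvE integral_dirac//; last exact: measurable_fun_translate.
rewrite diracE in_setT mul1e; congr (p _).
by apply/seteqP; split=> y; rewrite /translate/= addr0.
Qed.

Lemma mconv_mzero p A :
  mconv p (mzero : {finite_measure set T -> \bar R}) A = 0%E.
Proof. by rewrite mconvE integral_measure_zero. Qed.

Lemma chmul1 V A : measurable A -> fine (chmul V (chone T R) A) = fine (V A).
Proof.
move=> mA.
have r1 : charge_diff (chone T R) (\d_(0 : T)) mzero.
  by move=> B mB; rewrite /= subr0.
rewrite (chmul_diff (fine_charge_posneg V) r1 mA) !fine_madd// !fine_mconv /convr.
rewrite [X in fine X + _ - _]mconv_dirac// [X in _ + fine X - _]mconv_mzero.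
rewrite [X in _ - (fine X + _)]mconv_mzero [X in _ - (_ + fine X)]mconv_dirac//.
by rewrite addr0 add0r -fine_charge_posneg.
Qed.

Lemma charge_normM V W : charge_norm (chmul V W) <= charge_norm V * charge_norm W.
Proof.
have rV := fine_charge_posneg V; have rW := fine_charge_posneg W.
apply: (le_trans (charge_norm_diff_le (chmul_diff rV rW))).
rewrite !fine_madd//.
have mT p r : fine (fmconv p r [set: T]) = fine (p [set: T]) * fine (r [set: T]).
  by rewrite -fineM ?fin_num_measure//; congr fine; exact: mconvT.
rewrite !mT !charge_norm_posneg; lra.
Qed.

End convolution.

(** * The algebra of signed measures *)

Section charge_class.
Context d (T : measurableAbGroupType d) (R : realType).
Implicit Types (V W U : charge T R) (A : set T).

Definition charge_val V A : R := if `[< measurable A >] then fine (V A) else 0.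

(** Signed measures up to equality on measurable sets, represented canonically by
    their values there and by [0] on the other sets. *)
Record charge_class := ChargeClass {
  class_val : set T -> R ;
  class_valP : exists V, class_val = charge_val V }.

Implicit Types x y z : charge_class.

HB.instance Definition _ := gen_eqMixin charge_class.
HB.instance Definition _ := gen_choiceMixin charge_class.

Definition cls V : charge_class := ChargeClass (ex_intro _ V erefl).

Definition repr_charge x : charge T R := sval (cid (class_valP x)).

Lemma repr_chargeK : cancel repr_charge cls.
Proof.
case=> f fP; rewrite /cls /repr_charge /=; case: cid => V /= fV.
by subst f; congr ChargeClass; exact: Prop_irrelevance.
Qed.

Lemma eq_clsP V W :
  cls V = cls W <-> forall A, measurable A -> fine (V A) = fine (W A).
Proof.
split=> [VW A mA|VW].
  have /(congr1 (fun f => f A)) : charge_val V = charge_val W by case: VW.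
  by rewrite /charge_val; case: asboolP.
have E : charge_val V = charge_val W.
  by apply/funext => A; rewrite /charge_val; case: asboolP => // /VW.
rewrite /cls; move: (ex_intro _ V _) (ex_intro _ W _).
by rewrite E => h1 h2; congr ChargeClass; exact: Prop_irrelevance.
Qed.

Lemma repr_clsE V A : measurable A -> fine (repr_charge (cls V) A) = fine (V A).
Proof. by move: A; apply/eq_clsP; rewrite repr_chargeK. Qed.

Lemma fine_chadd V W A : measurable A -> fine (chadd V W A) = fine (V A) + fine (W A).
Proof. by move=> mA; rewrite /chadd /cadd/= fineD ?fin_num_measure. Qed.

Lemma fine_copp V A : measurable A -> fine ((copp V : charge T R) A) = - fine (V A).
Proof. by move=> mA; rewrite /copp/= fineN. Qed.

Lemma fine_cscale c V A : measurable A ->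
  fine ((cscale c V : charge T R) A) = c * fine (V A).
Proof. by move=> mA; rewrite /cscale/= fineM ?fin_num_measure. Qed.

Definition class_zero := cls (chzero T R).
Definition class_opp x := cls (copp (repr_charge x)).
Definition class_add x y := cls (chadd (repr_charge x) (repr_charge y)).
Definition class_one := cls (chone T R).
Definition class_mul x y := cls (chmul (repr_charge x) (repr_charge y)).
Definition class_scale (c : R) x := cls (cscale c (repr_charge x)).

Lemma cls_add V W : class_add (cls V) (cls W) = cls (chadd V W).
Proof. by apply/eq_clsP => A mA; rewrite !fine_chadd// !repr_clsE. Qed.

Lemma cls_opp V : class_opp (cls V) = cls (copp V).
Proof. by apply/eq_clsP => A mA; rewrite !fine_copp// !repr_clsE. Qed.

Lemma cls_mul V W : class_mul (cls V) (cls W) = cls (chmul V W).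
Proof.
by apply/eq_clsP => A mA; apply: eq_chmul => // B mB; rewrite repr_clsE.
Qed.

Lemma cls_scale c V : class_scale c (cls V) = cls (cscale c V).
Proof. by apply/eq_clsP => A mA; rewrite !fine_cscale// !repr_clsE. Qed.

Lemma class_ind (P : charge_class -> Prop) : (forall V, P (cls V)) -> forall x, P x.
Proof. by move=> h x; rewrite -(repr_chargeK x). Qed.

Let addA : associative class_add.
Proof.
elim/class_ind => V; elim/class_ind => W; elim/class_ind => U.
by rewrite !cls_add; apply/eq_clsP => A mA; rewrite !fine_chadd// addrA.
Qed.

Let addC : commutative class_add.
Proof.
elim/class_ind => V; elim/class_ind => W.
by rewrite !cls_add; apply/eq_clsP => A mA; rewrite !fine_chadd// addrC.
Qed.

Let add0 : left_id class_zero class_add.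
Proof.
elim/class_ind => V; rewrite cls_add; apply/eq_clsP => A mA.
by rewrite !fine_chadd// /chzero/= add0r.
Qed.

Let addN : left_inverse class_zero class_opp class_add.
Proof.
elim/class_ind => V; rewrite cls_opp cls_add; apply/eq_clsP => A mA.
by rewrite !fine_chadd// fine_copp// addNr.
Qed.

HB.instance Definition _ := GRing.isZmodule.Build charge_class addA addC add0 addN.

Let mulA : associative class_mul.
Proof.
elim/class_ind => V; elim/class_ind => W; elim/class_ind => U.
by rewrite !cls_mul; apply/eq_clsP => A mA; rewrite chmulA.
Qed.

Let mulC : commutative class_mul.
Proof.
elim/class_ind => V; elim/class_ind => W.
by rewrite !cls_mul; apply/eq_clsP => A mA; rewrite chmulC.
Qed.

Let mul1 : left_id class_one class_mul.
Proof.
elim/class_ind => V; rewrite mulC cls_mul; apply/eq_clsP => A mA.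
by rewrite chmul1.
Qed.

Let mulDl : left_distributive class_mul class_add.
Proof.
elim/class_ind => V; elim/class_ind => W; elim/class_ind => U.
rewrite !(cls_mul, cls_add); apply/eq_clsP => A mA.
by rewrite fine_chadd// chmulDl.
Qed.

Let one_neq0 : class_one != 0.
Proof.
apply/eqP => /eq_clsP /(_ [set: T] measurableT).
rewrite [LHS](congr1 fine (diracT R (0 : T))) /chzero/= => /eqP.
by rewrite oner_eq0.
Qed.

HB.instance Definition _ :=
  GRing.Zmodule_isComNzRing.Build charge_class mulA mulC mul1 mulDl one_neq0.

Let scaleA (a b : R) x : class_scale a (class_scale b x) = class_scale (a * b) x.
Proof.
elim/class_ind: x => V; rewrite !cls_scale; apply/eq_clsP => A mA.
by rewrite !fine_cscale// mulrA.
Qed.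

Let scale1 : left_id 1 class_scale.
Proof.
elim/class_ind => V; rewrite !cls_scale; apply/eq_clsP => A mA.
by rewrite !fine_cscale// mul1r.
Qed.

Let scaleDr : right_distributive class_scale +%R.
Proof.
move=> c; elim/class_ind => V; elim/class_ind => W.
rewrite [cls V + _]cls_add !cls_scale [RHS]cls_add; apply/eq_clsP => A mA.
by rewrite !(fine_cscale, fine_chadd)// mulrDr.
Qed.

Let scaleDl x : {morph class_scale^~ x : a b / a + b}.
Proof.
move=> a b; elim/class_ind: x => V; rewrite !cls_scale [RHS]cls_add.
by apply/eq_clsP => A mA; rewrite !(fine_cscale, fine_chadd)// mulrDl.
Qed.

HB.instance Definition _ :=
  GRing.Zmodule_isLmodule.Build R charge_class scaleA scale1 scaleDr scaleDl.

Let scaleAl (a : R) x y : a *: (x * y) = (a *: x) * y.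
Proof.
elim/class_ind: x => V; elim/class_ind: y => W.
rewrite [_ * _]cls_mul [a *: cls V]cls_scale [LHS]cls_scale [RHS]cls_mul.
by apply/eq_clsP => A mA; rewrite fine_cscale// chmulZl.
Qed.

HB.instance Definition _ := GRing.Lmodule_isLalgebra.Build R charge_class scaleAl.

HB.instance Definition _ := GRing.Lalgebra_isComAlgebra.Build R charge_class.

Lemma clsD V W : cls (chadd V W) = cls V + cls W.
Proof. by rewrite -cls_add. Qed.

Lemma clsB V W : cls (chsub V W) = cls V - cls W.
Proof. by rewrite /chsub -cls_add -cls_opp. Qed.

Lemma clsM V W : cls (chmul V W) = cls V * cls W.
Proof. by rewrite -cls_mul. Qed.

Lemma cls0 : cls (chzero T R) = 0. Proof. by []. Qed.

Lemma cls1 : cls (chone T R) = 1. Proof. by []. Qed.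

Lemma cls_sum (I : Type) (s : seq I) (P : pred I) (F : I -> charge T R) :
  cls (\big[@chadd d T R/@chzero d T R]_(i <- s | P i) F i) = \sum_(i <- s | P i) cls (F i).
Proof. exact: (big_morph cls clsD cls0). Qed.

Lemma cls_prod (I : Type) (s : seq I) (P : pred I) (F : I -> charge T R) :
  cls (\big[@chmul d T R/@chone d T R]_(i <- s | P i) F i) = \prod_(i <- s | P i) cls (F i).
Proof. exact: (big_morph cls clsM cls1). Qed.

Lemma clsX V k : cls (chpow V k) = cls V ^+ k.
Proof. by rewrite /chpow cls_prod prodr_const card_ord. Qed.

Definition class_norm x : R := charge_norm (repr_charge x).

(** The norm only depends on the values on measurable sets, through
    [charge_norm_hahn] and [charge_norm_disjoint]. *)
Lemma class_norm_cls V : class_norm (cls V) = charge_norm V.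
Proof.
rewrite /class_norm.
have h W U : cls W = cls U -> charge_norm W <= charge_norm U.
  move=> /eq_clsP WU; have [P [N [mP mN PN ->]]] := charge_norm_hahn W.
  apply: le_trans (charge_norm_disjoint U mP mN PN); rewrite !WU//.
  by rewrite lerD ?ler_norm// -normrN ler_norm.
by apply/eqP; rewrite eq_le !h// repr_chargeK.
Qed.

Lemma charge_norm_prob (P : probability T R) : charge_norm (chprob P) <= 1.
Proof.
have [B [N [mB mN _ ->]]] := charge_norm_hahn (chprob P).
have h : fine (P B) <= 1.
  apply: le_trans (fine_finite_measure_le P mB measurableT (@subsetT _ _)) _.
  by rewrite [X in X <= _](congr1 fine (probability_setT P)).
by apply: le_trans h; rewrite gerBl fine_ge0.
Qed.

Lemma class_seminorm : alg_seminorm class_norm.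
Proof.
split.
- by elim/class_ind => V; rewrite class_norm_cls charge_norm_ge0.
- elim/class_ind => V; elim/class_ind => W; rewrite -clsD !class_norm_cls.
  have [P [N [mP mN PN ->]]] := charge_norm_hahn (chadd V W).
  have := charge_norm_disjoint V mP mN PN; have := charge_norm_disjoint W mP mN PN.
  rewrite !fine_chadd//.
  have := ler_norm (fine (V P)); have := ler_norm (fine (W P)).
  have := ler_norm (- fine (V N)); have := ler_norm (- fine (W N)).
  rewrite !normrN; lra.
- elim/class_ind => V; elim/class_ind => W; rewrite -clsM !class_norm_cls.
  exact: charge_normM.
- move=> c; elim/class_ind => V; rewrite [c *: _]cls_scale !class_norm_cls.
  have [P [N [mP mN PN ->]]] := charge_norm_hahn (cscale c V).
  apply: (le_trans _ (ler_wpM2l (normr_ge0 c) (charge_norm_disjoint V mP mN PN))).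
  rewrite !fine_cscale// mulrDr -!normrM lerD ?ler_norm//.
  by rewrite -normrN ler_norm.
- by rewrite -cls1 class_norm_cls; exact: (charge_norm_prob \d_(0 : T)).
Qed.

End charge_class.

(** * Bounds for products of distributions *)

Section transport.
Context d (T : measurableAbGroupType d) (R : realType) (n : nat).
Variables (F : 'I_n -> probability T R) (G : probability T R).

Let f j := cls (chprob (F j)).
Let g := cls (chprob G).
Let N := @class_norm d T R.
Let semN : alg_seminorm N := @class_seminorm d T R.
Let f1 j : N (f j) <= 1. Proof. by rewrite /N class_norm_cls charge_norm_prob. Qed.
Let g1 : N g <= 1. Proof. by rewrite /N class_norm_cls charge_norm_prob. Qed.

Local Notation a := (term_norm N f g).
Local Notation D l := (charge_norm (chsub (prod_distr F) (approxW F G l))).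

Lemma cls_diffFG j : cls (diffFG F G j) = f j - g.
Proof. exact: clsB. Qed.

Lemma cls_termV k : cls (termV F G k) = elem_sym (fun j => f j - g) k.
Proof.
rewrite /termV cls_sum; apply: eq_bigr => J _; rewrite cls_prod.
by apply: eq_bigr => j _; exact: cls_diffFG.
Qed.

Lemma cls_smoothM j k : cls (smoothM F G j k) = smooth f g k j.
Proof. by rewrite /smoothM clsM clsX cls_diffFG. Qed.

Lemma remainderE l : D l = remainder N f g l.
Proof.
rewrite -class_norm_cls clsB cls_prod /approxW cls_sum; congr (N (_ - _)).
by apply: eq_bigr => k _; rewrite clsM clsX cls_termV.
Qed.

Lemma nuE k m : nu F G k m = \sum_j N (smooth f g k j) ^+ m.
Proof. by apply: eq_bigr => j _; rewrite -class_norm_cls cls_smoothM. Qed.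

Lemma nu_tildeE k : nu_tilde F G k = N (\sum_j smooth f g k j).
Proof.
rewrite /nu_tilde -class_norm_cls cls_sum; congr N.
by apply: eq_bigr => j _; exact: cls_smoothM.
Qed.

Lemma eta_ge0 l : 0 <= Defs.eta F G l.
Proof. exact: bigmax_ge_id. Qed.

Lemma le_eta l k : (l < k <= n)%N ->
  k%:R^-1 * (nu_tilde F G k ^+ 2 / (4 * c1 R) + nu F G k 2) <= Defs.eta F G l.
Proof.
move=> /andP[lk kn]; rewrite /Defs.eta.
by apply: (@bigmax_sup_seq _ _ _ _ _ k) => //; rewrite mem_index_iota lk.
Qed.

Lemma term_norm_eta l k : (l < k)%N -> a k <= (kappa R * Num.sqrt (Defs.eta F G l)) ^+ k.
Proof.
move=> lk; have k0 : (0 < k)%N by exact: leq_ltn_trans lk.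
have [kn|nk] := leqP k n; last first.
  by rewrite term_norm_gt// exprn_ge0// mulr_ge0 ?sqrtr_ge0// ltW// kappa_gt0.
apply: term_norm_le => //; rewrite -nu_tildeE -nuE.
by apply: le_eta; rewrite lk.
Qed.

Lemma remainder_le l (xl : R) : (l <= n)%N -> 0 < xl < 1 ->
  xl ^+ l.+1 + xl / 2 = 1 ->
  D l <= kappa R ^+ l.+1 / (1 - xl) * Num.sqrt (Defs.eta F G 0) ^+ l.+1.
Proof.
move=> ln xl01 xlE; rewrite remainderE mulrAC -exprMn.
have x0 : 0 <= kappa R * Num.sqrt (Defs.eta F G 0).
  by rewrite mulr_ge0 ?sqrtr_ge0// ltW// kappa_gt0.
apply: (@crossover_le _ _ _ _ l 1 n.+1) => //.
- by rewrite expr1; lra.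
- apply: (le_trans (remainder_le_tail semN f g ln (ltnSn n))).
  rewrite big_nat [leRHS]big_nat; apply: ler_sum => k /andP[lk _].
  by apply: term_norm_eta; exact: leq_ltn_trans lk.
- apply: (le_trans (remainder_le_head semN g f1 l)).
  rewrite big_ltn// addrA; apply: lerD.
    by have := term_norm0 semN f g1; lra.
  rewrite big_nat [leRHS]big_nat; apply: ler_sum => k /andP[k0 _].
  exact: term_norm_eta.
Qed.

Section mean.
Hypotheses (n0 : (0 < n)%N) (FG : mean_distr F G).

Lemma fine_sum_charge (I : Type) (s : seq I) (V : I -> charge T R) A :
  measurable A ->
  fine ((\big[@chadd d T R/@chzero d T R]_(i <- s) V i) A) = \sum_(i <- s) fine (V i A).
Proof.
move=> mA; elim/big_rec2 : _ => // i y W _ <-.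
by rewrite fine_chadd.
Qed.

(** This is what the mean assumption amounts to in the algebra; it kills the term of
    order [1] and the quantities [nu_tilde]. *)
Lemma sum_diff0 : \sum_j (f j - g) = 0.
Proof.
under eq_bigr do rewrite -cls_diffFG.
rewrite -cls_sum -cls0; apply/eq_clsP => A mA; rewrite fine_sum_charge//.
have GA : fine (G A) = n%:R^-1 * \sum_j fine (F j A).
  rewrite (FG mA) fineM//; last by apply/sum_fin_numP => j _ _; rewrite fin_num_measure.
  by congr (_ * _); rewrite sum_fine// => j _; rewrite fin_num_measure.
have FE j : fine (diffFG F G j A) = fine (F j A) - fine (G A).
  by rewrite /diffFG /chsub fine_chadd// fine_copp.
rewrite (eq_bigr _ (fun j _ => FE j)) sumrB sumr_const card_ord GA -[(_ * _) *+ n]mulr_natl.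
by rewrite mulrA mulfV ?mul1r ?subrr ?pnatr_eq0 -?lt0n.
Qed.

Local Notation s := (Num.sqrt (Defs.eta F G 1)).

Lemma term_norm_mean_bounds : mean_bounds a s.
Proof.
split; first exact: sqrtr_ge0.
  move=> k r /andP[k2 k8] r0 kr; have [kn|nk] := leqP k n; last first.
    by rewrite term_norm_gt// mulr_ge0 ?exprn_ge0 ?mulr_ge0 ?sqrtr_ge0//
      exp23_coef_ge0 ?invr_ge0.
  apply: term_norm_small => //; rewrite ?k2 ?k8 ?eta_ge0//; first exact: sum_diff0.
  rewrite -nuE; apply: le_trans (le_eta (l := 1) (k := k) _); last by rewrite k2.
  rewrite ler_wpM2l ?invr_ge0// lerDr divr_ge0 ?exprn_ge0//.
    by rewrite nu_tildeE (seminorm_ge0 semN).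
  by rewrite mulr_ge0// ltW// c1_gt0.
by move=> k k2; exact: term_norm_eta.
Qed.

Lemma remainder_le_tail_mean l m : (l <= n)%N -> (n < m)%N ->
  D l <= \sum_(l.+1 <= k < m) a k.
Proof. by move=> ln nm; rewrite remainderE; exact: remainder_le_tail. Qed.

Lemma remainder_le_head_mean l : (0 < l)%N -> D l <= 2 + \sum_(2 <= k < l.+1) a k.
Proof.
move=> l0; rewrite remainderE; apply: (le_trans (remainder_le_head semN g f1 l)).
rewrite big_ltn// big_ltn// term_norm1 ?sum_diff0// add0r addrA lerD2r.
by have := term_norm0 semN f g1; lra.
Qed.

Lemma remainder_mean_le l (xl : R) : (0 < l)%N -> (l <= n)%N -> 0 < xl < 1 ->
  xl ^+ l.+1 - xl ^+ 2 / 2 + xl = 1 ->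
  D l <= kappa R ^+ l.+1 / (1 - xl) * s ^+ l.+1.
Proof.
move=> l0 ln xl01 xlE; rewrite mulrAC -exprMn.
have x0 : 0 <= kappa R * s.
  by rewrite mulr_ge0 ?sqrtr_ge0// ltW// kappa_gt0.
apply: (@crossover_le _ _ _ _ l 2 n.+1) => //.
- lra.
- apply: (le_trans (remainder_le_tail_mean ln (ltnSn n))).
  rewrite big_nat [leRHS]big_nat; apply: ler_sum => k /andP[lk _].
  by apply: term_norm_eta; exact: leq_ltn_trans lk.
- apply: (le_trans (remainder_le_head_mean l0)); rewrite lerD2l.
  rewrite big_nat [leRHS]big_nat; apply: ler_sum => k /andP[k0 _].
  exact: term_norm_eta.
Qed.

Lemma term_norm2 : a 2 <= s ^+ 2.
Proof.
have [_ small _] := term_norm_mean_bounds.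
have r2 : Num.sqrt 2 ^+ 2 = 2 :> R by rewrite sqr_sqrtr.
apply: le_trans (small 2%N (Num.sqrt 2) isT (sqrtr_ge0 _) _) _; first by rewrite r2.
by rewrite exprMn r2 /= mulrA mulVf// mul1r.
Qed.

Lemma remainder_mean_small : [/\ D 1 <= 1094 / 100 * s ^+ 2,
  (2 <= n)%N -> D 2 <= 315 / 10 * s ^+ 3 & (3 <= n)%N -> D 3 <= 822 / 10 * s ^+ 4].
Proof.
have ab := term_norm_mean_bounds.
have n9 : (9 <= n.+1 + 9)%N by rewrite leq_addl.
have nn : (n < n.+1 + 9)%N by rewrite leq_addr.
split=> [|n2|n3].
- apply: (mean_remainder1_le ab n9); first exact: remainder_le_tail_mean.
  by have := @remainder_le_head_mean 1 isT; rewrite big_geq// addr0.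
- apply: (mean_remainder2_le ab n9); [exact: remainder_le_tail_mean| |exact: term_norm2].
  by have := @remainder_le_head_mean 2 isT; rewrite big_nat1.
- apply: (mean_remainder3_le ab n9); [exact: remainder_le_tail_mean| |exact: term_norm2].
  by have := @remainder_le_head_mean 3 isT; rewrite big_ltn// big_nat1 addrA.
Qed.

End mean.
End transport.

(** * The smallest constants *)

Section smallest.
Variable R : realType.
Implicit Types (S : set R) (u v a b : R).

(** The third assumption says that [S] is upward closed and the last one that it is
    closed from above, so [S] is the half-line starting at its infimum. *)
Lemma smallest_element_inf S : S !=set0 -> lbound S 0 ->
  (forall u v, S u -> u <= v -> S v) ->
  (forall u, (forall v, u < v -> S v) -> S u) -> smallest_element S (inf S).
Proof.
move=> S0 lb0 S_up S_closed; have hinf : has_inf S by split=> //; exists 0.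
split; last exact: ge_inf (ex_intro _ 0 lb0).
apply: S_closed => v iv; have [s Ss sv] := inf_lt S0 iv.
exact: S_up (ltW sv).
Qed.

Lemma ler_mul_closed a b u : 0 <= b -> (forall v, u < v -> a <= v * b) -> a <= u * b.
Proof.
move=> b0 h; apply/ler_addgt0Pr => e e0.
have b1 : 0 < b + 1 by rewrite ltr_wpDl.
apply: (le_trans (h (u + e / (b + 1)) _)); first by rewrite ltrDl divr_gt0.
rewrite mulrDl lerD2l mulrAC ler_pdivrMr//.
by apply: ler_wpM2l; [exact: ltW | rewrite lerDl].
Qed.

End smallest.

Definition real_group (R : realType) : Type := R.

Section real_group.
Variable R : realType.

HB.instance Definition _ := Measurable.copy (real_group R) (measurableTypeR R).

Let subr_measurable : measurable_fun [set: real_group R * real_group R]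
  (fun z => (z.1 : R) + - (z.2 : R) : real_group R).
Proof.
apply: (@measurable_funB _ (measurableTypeR R * measurableTypeR R)%type R setT fst snd).
  exact: measurable_fst.
exact: measurable_snd.
Qed.

HB.instance Definition _ := isMeasurableAbGroup.Build _ (real_group R)
  (@addrA R) (@addrC R) (@add0r R) (@addNr R) subr_measurable.

End real_group.

Section nondegenerate.
Variable R : realType.

(** At [k = n] there is no smoothing, and the sum of squares contains the squared
    norm of [F j - G]. *)
Lemma eta_gt0 d (T : measurableAbGroupType d) n (F : 'I_n -> probability T R)
    (G : probability T R) l j A :
  measurable A -> fine (F j A) != fine (G A) -> (l < n)%N ->
  0 < Defs.eta F G l.
Proof.
move=> mA FG ln; apply: lt_le_trans (le_eta F G (l := l) (k := n) _); last first.
  by rewrite ln leqnn.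
have n0 : (0 < n)%N := leq_ltn_trans (leq0n l) ln.
rewrite mulr_gt0 ?invr_gt0 ?ltr0n// ltr_wpDl//.
  by rewrite divr_ge0 ?exprn_ge0 ?charge_norm_ge0// mulr_ge0// ltW// c1_gt0.
rewrite /nu (bigD1 j)//= ltr_pwDl//; last first.
  by rewrite sumr_ge0// => i _; rewrite exprn_ge0// charge_norm_ge0.
rewrite exprn_gt0// -class_norm_cls cls_smoothM /smooth subnn div0n expr0 mulr1.
rewrite -cls_diffFG class_norm_cls.
have := charge_norm_disjoint (diffFG F G j) mA measurable0 (setI0 _).
apply: lt_le_trans; rewrite ltr_pwDl// normr_gt0.
by rewrite /diffFG /chsub fine_chadd// fine_copp// subr_eq0.
Qed.

Local Notation T := (real_group R).
Let at0 : probability T R := \d_((0 : R) : T).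
Let at1 : probability T R := \d_((1 : R) : T).

Let m0 : measurable [set ((0 : R) : T)].
Proof. exact: (@measurable_set1 R 0). Qed.

Let at0E : fine (at0 [set ((0 : R) : T)]) = 1.
Proof. by rewrite [X in fine X](diracE R ((0 : R) : T)) mem_set. Qed.

Let at1E : fine (at1 [set ((0 : R) : T)]) = 0.
Proof.
rewrite [X in fine X](diracE R ((1 : R) : T)) memNset//= => /eqP; apply/negP.
exact: oner_neq0.
Qed.

(** Taking the point mass at [0] for all [F j] and the point mass at [1] for [G] makes
    [eta] positive, and then the error bound forces [0 <= u]. *)
Lemma admissible_ge0 l u : admissible R l u -> 0 <= u.
Proof.
move=> /(_ _ T l.+1 (fun _ => at0) at1 isT (leqnSn l)) h.
have e0 : 0 < Defs.eta (fun _ : 'I_l.+1 => at0) at1 0.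
  by apply: (eta_gt0 (j := ord0) m0) => //; rewrite [X in X != _]at0E [X in _ != X]at1E oner_neq0.
have := le_trans (charge_norm_ge0 _) h.
by rewrite pmulr_lge0// powR_gt0.
Qed.

(** The mean of one point mass at [0] and [m] point masses at [1]. *)
Definition two_point (m : nat) : set T -> \bar R :=
  measure_add (mscale (m.+1%:R^-1)%:nng at0) (mscale (m%:R / m.+1%:R)%:nng at1).

HB.instance Definition _ m := Measure.on (two_point m).

Lemma two_pointE m A :
  two_point m A = ((m.+1%:R^-1)%:E * at0 A + (m%:R / m.+1%:R)%:E * at1 A)%E.
Proof. by rewrite /two_point measure_addE. Qed.

Lemma fine_two_point m A : measurable A -> fine (two_point m A) =
  m.+1%:R^-1 * fine (at0 A) + m%:R / m.+1%:R * fine (at1 A).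
Proof.
by move=> mA; rewrite two_pointE fineD ?fineM ?fin_numM ?fin_num_measure.
Qed.

Let two_point_setT m : two_point m [set: T] = 1%E.
Proof.
rewrite two_pointE !probability_setT !mule1 -EFinD -[X in X + _]mul1r -mulrDl nat1r.
by rewrite divff// pnatr_eq0.
Qed.

HB.instance Definition _ m :=
  Measure_isProbability.Build _ _ _ (two_point m) (two_point_setT m).

(** As in [admissible_ge0], with [l + 1] distributions: one is the point mass at [0]
    and the others are the point mass at [1].  The mean differs from the first one
    because [0 < l]. *)
Lemma admissible_mean_ge0 l u : (0 < l)%N -> admissible_mean R l u -> 0 <= u.
Proof.
move=> l0.
pose F (j : 'I_l.+1) := if j == ord0 then at0 else at1.
have FG : mean_distr F (two_point l).
  move=> A mA; rewrite [LHS]two_pointE.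
  have -> : (\sum_(j < l.+1) F j A = (fine (at0 A) + l%:R * fine (at1 A))%:E)%E.
    rewrite big_ord_recl /F eqxx (eq_bigr (fun=> (fine (at1 A))%:E)) => [|i _].
      by rewrite sumEFin sumr_const card_ord mulr_natl EFinD fineK ?fin_num_measure.
    by rewrite [RHS]fineK ?fin_num_measure.
  rewrite -[X in (_ * X + _)%E]fineK ?fin_num_measure//.
  rewrite -[X in (_ + _ * X)%E]fineK ?fin_num_measure//.
  rewrite -!EFinM -EFinD; congr (_%:E).
  by field; rewrite addrC natr1 pnatr_eq0.
move=> /(_ _ T l.+1 F (two_point l) isT (leqnSn l) FG) h.
have e0 : 0 < Defs.eta F (two_point l) 1.
  apply: (eta_gt0 (j := ord0) m0) => //; rewrite /F eqxx [X in X != _]at0E.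
  rewrite [X in _ != X]fine_two_point// [X in _ != _ * X + _]at0E [X in _ != _ + _ * X]at1E.
  rewrite mulr1 mulr0 addr0 eq_sym invr_eq1 pnatr_eq1 eqSS -lt0n.
  exact: l0.
have := le_trans (charge_norm_ge0 _) h.
by rewrite pmulr_lge0// powR_gt0.
Qed.

End nondegenerate.

Section main.
Variable R : realType.

Lemma powR_kappa l : (2 * expR 1 * c1 R) `^ (l%:R / 2) = kappa R ^+ l.
Proof.
by rewrite powR_half// !mulr_ge0 ?expR_ge0// ltW// c1_gt0.
Qed.

Lemma admissible_crossover l (x : R) : 0 < x < 1 -> x ^+ l.+1 + x / 2 = 1 ->
  admissible R l (kappa R ^+ l.+1 / (1 - x)).
Proof.
move=> x01 xE d T n F G n0 ln; rewrite powR_half ?eta_ge0//.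
exact: remainder_le.
Qed.

Lemma admissible_mean_crossover l (x : R) : (0 < l)%N -> 0 < x < 1 ->
  x ^+ l.+1 - x ^+ 2 / 2 + x = 1 ->
  admissible_mean R l (kappa R ^+ l.+1 / (1 - x)).
Proof.
move=> l0 x01 xE d T n F G n0 ln FG; rewrite powR_half ?eta_ge0//.
exact: remainder_mean_le.
Qed.

Lemma admissible_mean_small : [/\ admissible_mean R 1 (1094 / 100),
  admissible_mean R 2 (315 / 10) & admissible_mean R 3 (822 / 10)].
Proof.
split=> d T n F G n0 ln FG; rewrite powR_half ?eta_ge0//;
  have [D1 D2 D3] := remainder_mean_small n0 FG.
- exact: D1.
- exact: D2.
- exact: D3.
Qed.

Lemma smallest_admissible l :
  smallest_element (admissible R l) (inf (admissible R l)).
Proof.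
apply: smallest_element_inf.
- have [x [[x0 xE _] x1]] := crossover_point_ex R l.
  by exists (kappa R ^+ l.+1 / (1 - x)); apply: admissible_crossover => //; rewrite x0.
- exact: admissible_ge0.
- move=> u v hu uv d T n F G n0 ln; apply: (le_trans (hu _ _ _ _ _ n0 ln)).
  by rewrite ler_wpM2r// powR_ge0.
- move=> u hu d T n F G n0 ln; apply: ler_mul_closed; first exact: powR_ge0.
  by move=> v /hu; apply.
Qed.

Lemma smallest_admissible_mean l : (0 < l)%N ->
  smallest_element (admissible_mean R l) (inf (admissible_mean R l)).
Proof.
move=> l0; apply: smallest_element_inf.
- have [x [[x0 xE _] x1]] := crossover_point_mean_ex R l0.
  exists (kappa R ^+ l.+1 / (1 - x)).
  by apply: admissible_mean_crossover => //; rewrite x0.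
- by move=> u; exact: admissible_mean_ge0.
- move=> u v hu uv d T n F G n0 ln FG; apply: (le_trans (hu _ _ _ _ _ n0 ln FG)).
  by rewrite ler_wpM2r// powR_ge0.
- move=> u hu d T n F G n0 ln FG; apply: ler_mul_closed; first exact: powR_ge0.
  by move=> v /hu; apply.
Qed.

End main.

Theorem theorem2p2 (R : realType) :
  (exists u : nat -> R,
    [/\ forall l : nat, smallest_element (admissible R l) (u l),
        forall l : nat, exists x : R,
          [/\ unique_positive_solution
                (fun y => y ^+ l.+1 + y / 2 = 1) x,
              x < 1 &
              u l <= (2 * expR 1 * c1 R) `^ (l.+1%:R / 2) / (1 - x)] &
        [/\ u 0%N <= 59 / 10, u 1%N <= 173 / 10,
            u 2%N <= 445 / 10 & u 3%N <= 1075 / 10]]) /\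
  (exists ut : nat -> R,
    [/\ forall l : nat, (1 <= l)%N ->
          smallest_element (admissible_mean R l) (ut l),
        [/\ ut 1%N <= 1094 / 100, ut 2%N <= 315 / 10 & ut 3%N <= 822 / 10] &
        forall l : nat, (4 <= l)%N -> exists x : R,
          [/\ unique_positive_solution
                (fun y => y ^+ l.+1 - y ^+ 2 / 2 + y = 1) x,
              x < 1 &
              ut l <= (2 * expR 1 * c1 R) `^ (l.+1%:R / 2) / (1 - x)]]).
Proof.
split.
  have small := smallest_admissible R.
  have u_le l (x : R) : 0 < x < 1 -> x ^+ l.+1 + x / 2 = 1 ->
      inf (admissible R l) <= kappa R ^+ l.+1 / (1 - x).
    by move=> x01 xE; apply: (small l).2; exact: admissible_crossover.
  have bound l b : (forall x, x ^+ l.+1 + x / 2 = 1 -> kappa R ^+ l.+1 / (1 - x) <= b) ->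
      inf (admissible R l) <= b.
    move=> h; have [x [[x0 xE _] x1]] := crossover_point_ex R l.
    by apply: le_trans (h x xE); apply: u_le => //; rewrite x0.
  exists (fun l => inf (admissible R l)); split=> //.
    move=> l; have [x [sol x1]] := crossover_point_ex R l; exists x; split=> //.
    by have [x0 xE _] := sol; rewrite powR_kappa; apply: u_le => //; rewrite x0.
  by split; apply: bound => x; have [] := kappa_small_bounds x.
have small l (l0 : (0 < l)%N) := smallest_admissible_mean R l0.
have [a1 a2 a3] := admissible_mean_small R.
exists (fun l => inf (admissible_mean R l)); split=> //.
  by split; [exact: (small 1%N isT).2 | exact: (small 2%N isT).2 | exact: (small 3%N isT).2].
move=> l l4; have l0 : (0 < l)%N by exact: leq_trans l4.
have [x [sol x1]] := crossover_point_mean_ex R l0; exists x; split=> //.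
have [x0 xE _] := sol; rewrite powR_kappa.
by apply: (small l l0).2; apply: admissible_mean_crossover => //; rewrite x0.
Qed.
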